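(* Let $M$ be a matroid of rank $r\geq 3$ on $n$ elements. Then $$\ln\#\mathcal{D}(M)\leq \frac{55\ln(n)+4\ln(n)^2}{n}\binom{n}{r}.$$
   Context: For a matroid $M=(E,\mathcal{B})$ of rank $r$ and $\nu:\mathcal{B}\to\mathbb{R}$, let $\overline{\nu}:\binom{E}{r}\to\mathbb{R}\cup\{\infty\}$ extend $\nu$ by $\infty$ outside $\mathcal{B}$. $\nu$ is a valuation of $M$ if for all $B,B'\in\binom{E}{r}$ and $e\in B\setminus B'$ there is $f\in B'\setminus B$ with $\overline{\nu}(B)+\overline{\nu}(B')\geq\overline{\nu}(B-e+f)+\overline{\nu}(B'+e-f)$. Let $Z(r,E)$ be the set of triples $(S,ab,cd)$ with $S\in\binom{E}{r-2}$ and $a,b,c,d\in E\setminus S$ distinct; $Sab:=S\cup\{a,b\}$ etc. Put $[\overline{\nu}]:=\{(S,ab,cd)\in Z(r,E):\overline{\nu}(Sac)+\overline{\nu}(Sbd)=\overline{\nu}(Sad)+\overline{\nu}(Sbc)\}$; valuations $\nu,\nu'$ are combinatorially equivalent if $[\overline{\nu}]=[\overline{\nu'}]$. The cells of the fan $\mathcal{D}(M)$ are the topological closures (in $\mathbb{R}^{\mathcal{B}}$) of the combinatorial equivalence classes of valuations of $M$, and $\#\mathcal{D}(M)$ denotes the number of cells. *)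

(* Defs.v *)
From HB Require Import structures.
From mathcomp Require Export all_boot all_order all_algebra.
From mathcomp Require Export finmap.
From mathcomp Require Export all_classical all_reals all_analysis.

Set Implicit Arguments.
Unset Strict Implicit.
Unset Printing Implicit Defensive.

Import Order.TTheory GRing.Theory Num.Theory.
Import numFieldNormedType.Exports.

Local Open Scope ring_scope.
Local Open Scope set_scope. (* finite sets; classical sets are marked %classic *)

Record matroid (E : finType) := Matroid {
  bases : {set {set E}};
  bases_neq0 : bases != finset.set0;
  bases_exchange : forall B1 B2 : {set E}, B1 \in bases -> B2 \in bases ->
    forall e, e \in B1 :\: B2 ->
    exists2 f, f \in B2 :\: B1 & f |: (B1 :\ e) \in bases }.

(* All bases have the same cardinality (card_basis below); the maximum is only
   a way to name it. *)
Definition mrank (E : finType) (M : matroid E) : nat :=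
  \max_(B in bases M) #|B|.

Lemma card_basis_le (E : finType) (M : matroid E) (B1 B2 : {set E}) :
  B1 \in bases M -> B2 \in bases M -> (#|B1| <= #|B2|)%N.
Proof.
move: {2}(#|B1 :\: B2|) (erefl #|B1 :\: B2|) => k.
elim: k B1 => [|k IH] B1 Dk B1M B2M.
  by apply: subset_leq_card; rewrite -finset.setD_eq0 -cards_eq0 Dk.
have [e eD] : exists e, e \in B1 :\: B2 by apply/card_gt0P; rewrite Dk.
have [f fD BM] := bases_exchange B1M B2M eD.
move: (eD) (fD); rewrite !finset.in_setD => /andP[eN2 e1] /andP[fN1 f2].
have -> : #|B1| = #|f |: (B1 :\ e)|.
  by rewrite cardsU1 !inE (negbTE fN1) andbF (cardsD1 e B1) e1.
apply: IH => //.
have -> : (f |: (B1 :\ e)) :\: B2 = (B1 :\: B2) :\ e.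
  apply/setP => x; rewrite !inE; have [->|_] := eqVneq x f.
    by rewrite f2 andbF.
  by rewrite /= andbCA.
by move: Dk; rewrite (cardsD1 e) eD => -[].
Qed.

Lemma card_basis (E : finType) (M : matroid E) (B : {set E}) :
  B \in bases M -> #|B| = mrank M.
Proof.
move=> BM; apply/eqP; rewrite eqn_leq /mrank; apply/andP; split.
  exact: (@bigop.leq_bigmax_cond _ (mem (bases M)) (fun A : {set E} => #|A|) B BM).
by apply/bigop.bigmax_leqP => B' B'M; apply: card_basis_le B'M BM.
Qed.

Definition add_pair (E : finType) (S : {set E}) (x y : E) : {set E} :=
  S :|: [set x; y].

Definition basis_of (E : finType) (M : matroid E) := {B : {set E} | B \in bases M}.

(* R^(bases M); the index set is finite, so the topology of pointwise
   convergence is the Euclidean one. *)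
Definition basis_space (R : realType) (E : finType) (M : matroid E) :=
  {ptws (basis_of M) -> R}.

Section Valuations.
Variables (R : realType) (E : finType) (M : matroid E).
Implicit Types nu : basis_space R M.

(* Defined on all subsets of E, but only used on those of cardinality mrank M. *)
Definition extend nu (B : {set E}) : \bar R :=
  if insub B is Some b then (nu (b : basis_of M))%:E else +oo%E.

Definition valuation nu : Prop :=
  forall B B' : {set E}, #|B| = mrank M -> #|B'| = mrank M ->
  forall e, e \in B :\: B' ->
  exists2 f, f \in B' :\: B &
    (extend nu (f |: (B :\ e)) + extend nu ((e |: B') :\ f)
       <= extend nu B + extend nu B')%E.

(* The set [nu] of triples (S, ab, cd), where ab and cd are unordered pairs;
   the defining equation is invariant under swapping a and b, or c and d. *)
Definition degenerate_triples nu : set ({set E} * {set E} * {set E}) :=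
  [set t | exists (S : {set E}) (a b c d : E),
    [/\ #|S|.+2 = mrank M,
        uniq [:: a; b; c; d],
        all (fun x => x \notin S) [:: a; b; c; d],
        t = (S, [set a; b]%SET, [set c; d]%SET) &
        (extend nu (add_pair S a c) + extend nu (add_pair S b d)
         = extend nu (add_pair S a d) + extend nu (add_pair S b c))%E ]]%classic.

Definition comb_equiv nu nu' : Prop :=
  degenerate_triples nu = degenerate_triples nu'.

Definition comb_class nu : set (basis_space R M) :=
  [set nu' | valuation nu' /\ comb_equiv nu nu']%classic.

Definition fan_cells : set (set (basis_space R M)) :=
  [set C | exists2 nu, valuation nu & C = closure (comb_class nu)]%classic.

(* fset_set returns the empty set on infinite sets, so this is meaningful only
   together with finite_set fan_cells. *)
Definition num_cells : nat := #|` fset_set fan_cells|%fset.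

End Valuations.
Arguments fan_cells R {E} M.
Arguments num_cells R {E} M.

(* Main.v *)
Require Import Defs.
From mathcomp Require Import lra ring zify.
Import Order.TTheory GRing.Theory Num.Theory.
Local Open Scope ring_scope.
Set Implicit Arguments.
Unset Strict Implicit.
Unset Printing Implicit Defensive.

(* A cell is determined by the set of three-term equations that hold on it, and this set
   is closed under linear consequences. Reveal it blockwise, a block being the rank-2
   contraction at an [r-2]-set, or dually the corank-2 restriction to an [r+2]-set,
   whichever has [m >= n/2 + 2] elements. On a block, the valuation is a tree metric on
   [m] leaves: there are at most [(4m)^m] combinatorial types, and its equations leave at
   most [2m] degrees of freedom. Let [N = 'C(n, r)] and [D = 'C(m, 2)]. If the solution
   space of the known equations has dimension [d], then by averaging some block meets at
   least [d D / N] of [d] independent coordinates, so revealing it brings [d] down to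
   [(1 - D/N) d + 2m]. After about [(N/D) ln n] blocks, [d <= 9N/n], at a cost of
   [(N/D) ln n * m ln (4m)], which is about [(4N/n) (ln n)^2]. The remaining equations
   follow from at most [d] of them, chosen among at most [N n^4]; this costs about
   [(9N/n) * 5 ln n]. *)

(** * Ultrametrics up to order *)

Section UltrametricCode.
Local Open Scope order_scope.
Variables (m : nat) (A : pred 'I_m) (d : Order.disp_t) (T : orderType d).
Implicit Types (g : 'I_m -> 'I_m -> T) (a b c e x y : 'I_m).

(** Large values mean closeness: in a triangle inside [A] the least value is attained twice. Only
    the order of the values matters, and diagonal values carry no condition. *)
Definition ultrametric g :=
  (forall a b, g a b = g b a) /\
  forall a b c, A a -> A b -> A c -> uniq [:: a; b; c] ->
    (g a c <= g a b) || (g b c <= g a b).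

Lemma uniq3 (X : eqType) (a b c : X) : uniq [:: a; b; c] = [&& a != b, a != c & b != c].
Proof. by rewrite /= !inE negb_or andbT andbA. Qed.

Lemma uniq3_lt x a b : (a < x)%N -> (b < x)%N -> a != b -> uniq [:: x; a; b].
Proof. by move=> ax bx ab; rewrite uniq3 ab -!val_eqE /= !gtn_eqF. Qed.

Lemma isosceles g a b c : ultrametric g -> A a -> A b -> A c ->
  uniq [:: a; b; c] -> g a b < g a c -> g b c = g a b.
Proof.
move=> [gC gU] Aa Ab Ac; rewrite uniq3 => /and3P[ab ac bc] lt_abc.
apply/eqP; rewrite eq_le; apply/andP; split.
  have := gU a b c Aa Ab Ac; rewrite uniq3 ab ac bc => /(_ isT)/orP[|//].
  by rewrite leNgt lt_abc.
have := gU b c a Ab Ac Aa; rewrite uniq3 bc eq_sym ab eq_sym ac => /(_ isT)/orP[|].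
  by rewrite gC.
by rewrite gC => /(lt_le_trans lt_abc)/ltW.
Qed.

Definition nearest g x y := [&& A y, (y < x)%N &
  [forall y', A y' && (y' < x)%N ==> (g x y' <= g x y)]].

Definition in_ball g e y := [forall x', A x' && (x' < e)%N ==> (g e x' <= g e y)].

(* The code [(e, s, b)] of [x] describes how [x] hangs off the tree of its
   predecessors: the set of nearest predecessors is a ball, equal to [{e}] if [s]
   holds and otherwise to the smallest ball around [e] containing a predecessor of
   [e]; and [b] tells whether the distance from [x] to that ball is attained inside
   it. *)
Definition encodes g x (k : 'I_m * bool * bool) :=
  let: (e, s, b) := k in
  [&& nearest g x e,
   [forall y, nearest g x y == [&& A y, (y < x)%N & (y == e) || (~~ s && in_ball g e y)]] &
   b == [exists a, exists c, [&& nearest g x a, nearest g x c, a != c & g a c == g x a]]].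

(** For an ultrametric the default can occur only at points outside [A] or without a predecessor in
    [A], where there is nothing to record. *)
Definition ultra_code g : {ffun 'I_m -> 'I_m * bool * bool} :=
  [ffun x => odflt (x, false, false) [pick k | encodes g x k]].

Section Nearest.
Variables (g : 'I_m -> 'I_m -> T) (gU : ultrametric g) (x : 'I_m) (Ax : A x).

Lemma nearestP y : reflect
  [/\ A y, (y < x)%N & forall y', A y' -> (y' < x)%N -> g x y' <= g x y] (nearest g x y).
Proof.
apply: (iffP and3P) => [[Ay yx /forallP Hy]|[Ay yx Hy]]; split => //.
  by move=> y' Ay' y'x; have := Hy y'; rewrite Ay' y'x.
by apply/forallP => y'; apply/implyP => /andP[]; apply: Hy.
Qed.

Lemma nearest_eq y y' : nearest g x y -> nearest g x y' -> g x y = g x y'.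
Proof.
move=> /nearestP[Ay yx Hy] /nearestP[Ay' y'x Hy'].
by apply/eqP; rewrite eq_le Hy' ?Hy.
Qed.

Lemma not_nearest_lt y e : nearest g x e -> A y -> (y < x)%N -> ~~ nearest g x y ->
  g x y < g x e.
Proof.
move=> /nearestP[Ae ex He] Ay yx; rewrite ltNge; apply: contra => le_ey.
apply/nearestP; split => // y' Ay' y'x.
by apply: le_trans le_ey; apply: He.
Qed.

Lemma nearest_le y y' : nearest g x y -> nearest g x y' -> y != y' -> g x y <= g y y'.
Proof.
move=> Ny Ny' yy'; have [Ay yx _] := nearestP _ Ny.
have [Ay' y'x _] := nearestP _ Ny'.
have := gU.2 y y' x Ay Ay' Ax; rewrite uniq3 yy' -!val_eqE /= !ltn_eqF // => /(_ isT).
by rewrite !(gU.1 _ x) (nearest_eq Ny' Ny) orbb.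
Qed.

(** By the isosceles property a non-nearest point sees [x] as it sees [e]; this reduces values at
    [x] to earlier ones. *)
Lemma not_nearest_dist y e : nearest g x e -> A y -> (y < x)%N -> ~~ nearest g x y ->
  g y e = g x y.
Proof.
move=> Ne Ay yx Ny; have [Ae ex _] := nearestP _ Ne.
apply: isosceles => //; last exact: not_nearest_lt.
apply: uniq3_lt => //; by apply: contraNneq Ny => ->.
Qed.

Lemma encodes_exists : (exists y, A y && (y < x)%N) -> exists k, encodes g x k.
Proof.
move=> [y0 Hy0].
have [y1 Ny1] : exists y1, nearest g x y1.
  case: (@Order.TotalTheory.arg_maxP _ _ _ y0 (fun y => A y && (y < x)%N) (g x) Hy0) => y1 /andP[Ay1 y1x] Hy1.
  by exists y1; apply/nearestP; split => // y' Ay' y'x; apply: Hy1; rewrite Ay' y'x.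
set b := [exists a, exists c, [&& nearest g x a, nearest g x c, a != c & g a c == g x a]].
have [/existsP[y2 /andP[Ny2 ny2]]|] := boolP [exists y2, nearest g x y2 && (y2 != y1)]; last first.
  rewrite negb_exists => /forallP uniq_near.
  exists (y1, true, b); rewrite /encodes Ny1 eqxx andbT /=.
  apply/forallP => y; rewrite orbF; apply/eqP.
  have [->|yy1] := eqVneq y y1; first by have [-> ->] := nearestP _ Ny1.
  by rewrite !andbF; apply/negbTE; have := uniq_near y; rewrite yy1 andbT.
(* Finding the centre of the ball: [mu] is the earliest nearest point, [l] the least closeness to
   [mu] among the nearest points, and [e] the earliest one attaining it. Every predecessor of [e]
   then has closeness at most [l] to [e], with equality at [mu], so [in_ball g e] selects exactly
   the nearest points. *)
have [mu Nmu mu_min] : exists2 mu, nearest g x mu & forall y, nearest g x y -> (mu <= y)%N.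
  by case: (@arg_minnP _ y1 (nearest g x) (fun y => val y) Ny1) => mu ? ?; exists mu.
have [e0 [Ne0 ne0 e0_min]] : exists e0, [/\ nearest g x e0, e0 != mu &
    forall y, nearest g x y -> y != mu -> g mu e0 <= g mu y].
  have [y3 Hy3] : exists y3, nearest g x y3 && (y3 != mu).
    have [e1|n1] := eqVneq y1 mu; last by exists y1; rewrite Ny1.
    by exists y2; rewrite Ny2 -e1.
  case: (@Order.TotalTheory.arg_minP _ _ _ y3 (fun y => nearest g x y && (y != mu)) (g mu) Hy3) => e0 /andP[Ne0 ne0] He0.
  by exists e0; split => // y Ny ny; apply: He0; rewrite Ny ny.
set l := g mu e0 in e0_min.
have [e [Ne ne le] e_min] : exists2 e, [/\ nearest g x e, e != mu & g mu e = l] &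
    forall y, nearest g x y -> y != mu -> g mu y = l -> (e <= y)%N.
  have H0 : [&& nearest g x e0, e0 != mu & g mu e0 == l] by rewrite Ne0 ne0 eqxx.
  case: (@arg_minnP _ e0 (fun y => [&& nearest g x y, y != mu & g mu y == l]) (fun y => val y) H0) => e /and3P[? ? /eqP ?] He.
  exists e => // y Ny ny ly; apply: He; rewrite Ny ny ly eqxx //.
have mue : (mu < e)%N by rewrite ltn_neqAle mu_min // andbT eq_sym.
have [Amu mux _] := nearestP _ Nmu; have [Ae ex _] := nearestP _ Ne.
have leM : g x mu <= l by rewrite -le; apply: nearest_le; rewrite // eq_sym.
exists (e, false, b); rewrite /encodes Ne eqxx andbT /=.
apply/forallP => y; apply/eqP; apply/idP/idP => [Ny|/and3P[Ay yx]].
  have [-> -> _] := nearestP _ Ny => /=; have [//|ney /=] := eqVneq y e.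
  have ley : l <= g e y.
    have [->|nymu] := eqVneq y mu; first by rewrite gU.1 le.
    have [Ay _ _] := nearestP _ Ny.
    have := gU.2 e y mu Ae Ay Amu; rewrite uniq3 ne nymu eq_sym ney => /(_ isT).
    rewrite !(gU.1 _ mu) le => /orP[//|]; apply: le_trans; exact: e0_min.
  apply/forallP => x'; apply/implyP => /andP[Ax' x'e]; apply: le_trans ley.
  have x'x := ltn_trans x'e ex.
  have [Nx'|Nx'] := boolP (nearest g x x'); last first.
    rewrite gU.1 (not_nearest_dist Ne) //; apply: le_trans leM.
    by apply/ltW/not_nearest_lt.
  have [->|nx'] := eqVneq x' mu; first by rewrite gU.1 le.
  have lt_l : g mu e < g mu x'.
    rewrite le lt_neqAle e0_min // andbT; apply/negP => /eqP eq_l.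
    by have := e_min _ Nx' nx' (esym eq_l); rewrite leqNgt x'e.
  rewrite (@isosceles g mu e x') //; first by rewrite le.
  by rewrite uniq3 eq_sym ne eq_sym nx' -val_eqE /= gtn_eqF.
have [-> _|ney /=] := eqVneq y e; first exact: Ne.
move=> /forallP/(_ mu).
rewrite Amu mue /= gU.1 le => ley; apply/nearestP; split => // y' Ay' y'x.
have [_ _ /(_ y' Ay' y'x) He] := nearestP _ Ne.
apply: le_trans He _.
have := gU.2 x y e Ax Ay Ae (uniq3_lt yx ex ney).
case/orP => // le_ye; apply: le_trans le_ye; rewrite (gU.1 y); apply: le_trans ley.
by rewrite (nearest_eq Ne Nmu).
Qed.

(* The triangle condition propagates an attained minimum to every point [a]. *)
Lemma dist_attained e s t a c : encodes g x (e, s, t) -> nearest g x a -> nearest g x c ->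
  a != c -> (g a c <= g x a) =
    t && [forall y, nearest g x y && (y != a) ==> (g a c <= g a y)].
Proof.
move=> /and3P[Ne _ /eqP ->] Na Nc ac; apply/idP/idP => [le_ac|].
  apply/andP; split.
    apply/existsP; exists a; apply/existsP; exists c.
    by rewrite Na Nc ac eq_le le_ac nearest_le.
  apply/forallP => y; apply/implyP => /andP[Ny ya].
  by apply: le_trans le_ac _; apply: nearest_le => //; rewrite eq_sym.
case/andP => /existsP[a' /existsP[c' /and4P[Na' Nc' ac' /eqP eq_a'c']]] /forallP Hy.
have attained y : nearest g x y -> y != a -> g a y <= g x a -> g a c <= g x a.
  by move=> Ny ya; apply: le_trans; have := Hy y; rewrite Ny ya.
have [Aa _ _] := nearestP _ Na; have [Aa' _ _] := nearestP _ Na'; have [Ac' _ _] := nearestP _ Nc'.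
have [ea|na] := eqVneq a' a; first by apply: (attained c'); rewrite -?ea ?eq_a'c' // eq_sym.
have [ec|nc] := eqVneq c' a.
  by apply: (attained a') => //; rewrite -ec gU.1 eq_a'c' (nearest_eq Na' Nc').
have := gU.2 a' c' a Aa' Ac' Aa; rewrite uniq3 na nc ac' eq_a'c' => /(_ isT).
by rewrite (nearest_eq Na' Na) (gU.1 a' a) (gU.1 c' a) => /orP[]; apply: attained.
Qed.

End Nearest.

Definition same_triples g g' k := forall a b c, A a -> A b -> A c -> uniq [:: a; b; c] ->
  (a < k)%N -> (b < k)%N -> (c < k)%N -> (g a b <= g a c) = (g' a b <= g' a c).

(** The ball condition at [e] compares only values between points before [x], where [g] and [g']
    agree. *)
Lemma same_nearest g g' x k : encodes g x k -> encodes g' x k ->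
  same_triples g g' x -> nearest g x =1 nearest g' x.
Proof.
case: k => [[e s] b] /and3P[/nearestP[Ae ex _] /forallP H _] /and3P[_ /forallP H' _] gg' y.
rewrite (eqP (H y)) (eqP (H' y)).
have [Ay|//] := boolP (A y); have [yx|//] := boolP (y < x)%N.
have [//|ye] := eqVneq y e; congr [&& _, _ & _ || (_ && _)].
apply: eq_forallb => x'; have [Ax'|//] := boolP (A x'); have [x'e|//] := boolP (x' < e)%N.
have [->|x'y] := eqVneq x' y; first by rewrite !lexx.
rewrite /= gg' //; last exact: ltn_trans ex.
by rewrite uniq3 x'y (eq_sym e y) ye andbT /= -val_eqE /= gtn_eqF.
Qed.

(** Comparisons at the new point [x] reduce to earlier ones: a non-nearest point sees [x] as it sees
    [e], and for two nearest points [dist_attained] decides by the last bit of the code and earlier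
    values. *)
Lemma same_triplesS g g' x k : ultrametric g -> ultrametric g' -> A x ->
  encodes g x k -> encodes g' x k -> same_triples g g' x -> same_triples g g' x.+1.
Proof.
move=> gU g'U Ax kx kx' gg'; have NN := same_nearest kx kx' gg'.
case: k kx kx' => [[e s] b0] kx kx'.
have Ne : nearest g x e by case/and3P: kx.
have Ne' : nearest g' x e by case/and3P: kx'.
have [Ae ex _] := nearestP _ _ _ Ne.
have dist_x a c : A a -> A c -> (a < x)%N -> (c < x)%N -> a != c ->
    (g a x <= g a c) = (g' a x <= g' a c) /\ (g a c <= g a x) = (g' a c <= g' a x).
  move=> Aa Ac ax cx ac; rewrite !(gU.1 a x) !(g'U.1 a x).
  have [Na|Na] := boolP (nearest g x a); have Na' := Na; rewrite NN in Na'; last first.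
    rewrite -(not_nearest_dist gU Ax Ne) // -(not_nearest_dist g'U Ax Ne') //.
    have [<-|ec] := eqVneq e c; first by rewrite !lexx.
    have ae : a != e by apply: contra Na => /eqP ->.
    have ca : c != a by rewrite eq_sym.
    by split; apply: gg'; rewrite // uniq3 ?ae ?ac ?ec // eq_sym ec.
  have [Nc|Nc] := boolP (nearest g x c); have Nc' := Nc; rewrite NN in Nc'.
    split; first by rewrite !nearest_le.
    rewrite (dist_attained gU Ax kx) // (dist_attained g'U Ax kx') //.
    congr (_ && _); apply: eq_forallb => y; rewrite NN.
    have [/nearestP[Ay yx _]|//] := boolP (nearest g' x y).
    have [//|ya /=] := eqVneq y a.
    have [<-|cy] := eqVneq c y; first by rewrite !lexx.
    by apply: gg'; rewrite // uniq3 ac eq_sym ya cy.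
  have lt1 := not_nearest_lt Na Ac cx Nc; have lt2 := not_nearest_lt Na' Ac cx Nc'.
  rewrite (gU.1 a c) (g'U.1 a c).
  rewrite (not_nearest_dist gU Ax Na Ac cx Nc) (not_nearest_dist g'U Ax Na' Ac cx Nc').
  by rewrite !leNgt lt1 lt2 !(lt_gtF lt1) !(lt_gtF lt2).
have dist_xx b c : A b -> A c -> (b < x)%N -> (c < x)%N -> b != c ->
    (g x b <= g x c) = (g' x b <= g' x c).
  move=> Ab Ac bx cx bc.
  have [Nb|Nb] := boolP (nearest g x b); have Nb' := Nb; rewrite NN in Nb'.
    have [Nc|Nc] := boolP (nearest g x c); have Nc' := Nc; rewrite NN in Nc'.
      by rewrite (nearest_eq Nb Nc) (nearest_eq Nb' Nc') !lexx.
    by rewrite !leNgt (not_nearest_lt Nb) // (not_nearest_lt Nb').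
  have [Nc|Nc] := boolP (nearest g x c); have Nc' := Nc; rewrite NN in Nc'.
    by rewrite !ltW // not_nearest_lt.
  rewrite -(not_nearest_dist gU Ax Ne Ab) // -(not_nearest_dist g'U Ax Ne' Ab) //.
  rewrite -(not_nearest_dist gU Ax Ne Ac) // -(not_nearest_dist g'U Ax Ne' Ac) //.
  rewrite !(gU.1 _ e) !(g'U.1 _ e); apply: gg' => //.
  rewrite uniq3 bc andbT; apply/andP; split.
    by apply: contra Nb => /eqP <-.
  by apply: contra Nc => /eqP <-.
move=> a b c Aa Ab Ac; rewrite uniq3 => /and3P[ab ac bc]; rewrite !ltnS => ax bx cx.
have lt_x y : (y <= x)%N -> y != x -> (y < x)%N by rewrite ltn_neqAle => -> ->.
have [ea|na] := eqVneq a x.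
  by rewrite ea in ab ac *; apply: dist_xx => //; apply: lt_x; rewrite // eq_sym.
have [eb|nb] := eqVneq b x.
  by rewrite eb in bc ab *; apply: (dist_x _ _ _ _ _ _ _).1; rewrite ?lt_x // eq_sym.
have [ec|nc] := eqVneq c x.
  by rewrite ec in bc ac *; apply: (dist_x _ _ _ _ _ _ _).2; rewrite ?lt_x // eq_sym.
by apply: gg'; rewrite ?uniq3 ?ab ?ac ?bc ?lt_x.
Qed.

Lemma ultra_code_inj g g' : ultrametric g -> ultrametric g' ->
  ultra_code g = ultra_code g' ->
  forall a b c, A a -> A b -> A c -> uniq [:: a; b; c] ->
    (g a b <= g a c) = (g' a b <= g' a c).
Proof.
move=> gU g'U gg'.
suff agree k : (k <= m)%N -> same_triples g g' k by move=> a b c *; apply: (agree m).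
elim: k => [_ a b c //|k IHk km]; have {}IHk := IHk (ltnW km).
pose x := Ordinal km.
have [/andP[Ax /existsP Hx]|noy] := boolP (A x && [exists y : 'I_m, A y && (y < x)%N]).
  have [k1 Hk1] := encodes_exists gU Ax Hx; have [k2 Hk2] := encodes_exists g'U Ax Hx.
  have := congr1 (fun f : {ffun _} => f x) gg'; rewrite !ffunE.
  case: pickP => [c1 Hc1|/(_ k1)]; last by rewrite Hk1.
  case: pickP => [c2 Hc2|/(_ k2)]; last by rewrite Hk2.
  move=> /= c12; rewrite -c12 in Hc2.
  exact: (same_triplesS gU g'U Ax Hc1 Hc2).
(* Here [x] is outside [A] or is its first point, so no triple of distinct points of [A] up to [x]
   contains it. *)
move=> a b c Aa Ab Ac abc; rewrite !ltnS.
have notx y1 y2 : A y1 -> A y2 -> (y1 <= k)%N -> (y2 <= k)%N -> y1 != y2 -> (y1 < k)%N.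
  move=> A1 A2 le1 le2 ne; rewrite ltn_neqAle le1 andbT; apply/negP => /eqP e1.
  have ex : y1 = x by apply: val_inj.
  case/negP: noy; rewrite -ex A1; apply/existsP; exists y2.
  rewrite A2 ltn_neqAle {2}e1 le2 andbT; apply: contra ne => /eqP e2.
  by rewrite eq_sym -val_eqE; apply/eqP.
move: (abc); rewrite uniq3 => /and3P[ab ac bc] ak bk ck.
apply: IHk => //; first exact: (notx a b).
  by apply: (notx b a) => //; rewrite eq_sym.
by apply: (notx c a) => //; rewrite eq_sym.
Qed.

End UltrametricCode.

(** * Tree metrics *)

Section FourPoint.
Variables (R : realFieldType) (m : nat) (fin : rel 'I_m).
Hypothesis finC : symmetric fin.
Implicit Types (v u : 'I_m -> 'I_m -> R) (a b c d x y : 'I_m).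

(* [v a b] is a valuation of rank 2 (or corank 2), the pair [a, b] being a basis
   when [fin a b]; this is the three-term exchange axiom. *)
Definition four_point v :=
  (forall a b, v a b = v b a) /\
  forall a b c d, uniq [:: a; b; c; d] -> fin a b -> fin c d ->
    [&& fin a c, fin b d & v a c + v b d <= v a b + v c d] ||
    [&& fin a d, fin b c & v a d + v b c <= v a b + v c d].

Definition degenerate v a b c d :=
  [&& uniq [:: a; b; c; d], fin a c, fin b d, fin a d, fin b c &
   v a c + v b d == v a d + v b c].

Lemma uniq4 (X : eqType) (a b c d : X) : uniq [:: a; b; c; d] =
  [&& a != b, a != c, a != d, b != c, b != d & c != d].
Proof. by rewrite /= !inE !negb_or !andbT -!andbA. Qed.

Section Based.
Variables z o : 'I_m.
Hypotheses (zo : z != o) (fzo : fin z o).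

(** The points outside [A] are [z] and those forming no basis with [z]: they behave as loops or as
    parallel copies of [z]. *)
Let A : pred 'I_m := fun a => (a != z) && fin z a.

(** Twice the Gromov product at [z], with [- v] in the role of the tree metric; it turns the
    four-point condition at [z] into the ultrametric one. Pairs that are no basis are infinitely
    close. *)
Definition gromov v a b : \bar R :=
  if fin a b then (v a b - v z a - v z b)%:E else +oo%E.

Lemma gromov_ultra v : four_point v -> ultrametric A (gromov v).
Proof.
move=> [vC v4]; split=> [a b|a b c /andP[az fa] /andP[bz fb] /andP[cz fc]].
  by rewrite /gromov finC vC addrAC.
rewrite uniq3 => /and3P[ab ac bc]; rewrite /gromov.
have [fab|_] := boolP (fin a b); last by rewrite leey.
have := v4 a b c z; rewrite uniq4 ab ac az bc bz cz => /(_ isT fab).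
rewrite finC => /(_ fc) /orP[/and3P[-> _]|/and3P[_ ->]] /=.
  by rewrite lee_fin (vC b z) (vC c z) => le_v; apply/orP; left; lra.
by rewrite lee_fin (vC a z) (vC c z) => le_v; apply/orP; right; lra.
Qed.

Lemma gromov_finE v a b : fin a b -> gromov v a b = (v a b - v z a - v z b)%:E.
Proof. by rewrite /gromov => ->. Qed.

Lemma base_A : A o. Proof. by rewrite /A eq_sym zo. Qed.

(** Otherwise both exchanges between the bases [a c] and [z o] would need [z a] or [z c], and
    neither is a basis. *)
Lemma outside_A v a c : four_point v -> ~~ A a -> a != c -> fin a c -> A c.
Proof.
move=> [vC v4]; rewrite negb_and negbK => Aa ac fac.
have [ea|az] := eqVneq a z; first by rewrite /A -ea eq_sym ac.
have fza : fin z a = false by move: Aa; rewrite (negbTE az) => /negbTE.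
have cz : c != z by apply: contraFneq fza => <-; rewrite finC.
have ao : a != o by apply: contraFneq fza => ->.
rewrite /A cz /=; apply/negPn/negP => /negbTE fzc.
have co : c != o by apply: contraFneq fzc => ->.
have := v4 a c z o; rewrite uniq4 ac az ao cz co zo => /(_ isT fac fzo).
by rewrite (finC a z) (finC c z) fza fzc andbF.
Qed.

(** A parallel copy of [z] differs from [z] by an additive constant: one of the two exchanges
    between [a c] and [z d] uses the non-basis [a z], so the other must hold, and likewise with [c]
    and [d] swapped. *)
Lemma outside_shift v a c d : four_point v -> ~~ A a -> A c -> A d ->
  c != d -> fin a c -> fin a d -> v a c + v z d = v a d + v z c.
Proof.
move=> v4P Aa Ac Ad cd fac fad; have [vC v4] := v4P.
have [->|az] := eqVneq a z; first by rewrite addrC.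
have fza : fin z a = false by move: Aa; rewrite negb_and negbK (negbTE az) => /negbTE.
have ac : a != c by apply: contraNneq Aa => ->.
have ad : a != d by apply: contraNneq Aa => ->.
have [/andP[cz fzc] /andP[dz fzd]] := (Ac, Ad).
have half c' d' : c' != z -> d' != z -> c' != d' -> a != c' -> a != d' ->
    fin a c' -> fin z d' -> v a d' + v z c' <= v a c' + v z d'.
  move=> cz' dz' cd' ac' ad' fac' fzd'.
  have := v4 a c' z d'; rewrite uniq4 ac' az ad' cz' cd' eq_sym dz' => /(_ isT fac' fzd').
  by rewrite (finC a) fza /= => /and3P[_ _]; rewrite (vC c').
by apply/eqP; rewrite eq_le !half // eq_sym.
Qed.

(** By [outside_shift] the point [a] may be replaced by [z], where the equation compares two Gromov
    products at [b]; if [b] is outside too, it holds automatically. *)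
Lemma degenerate_outside v a b c d : four_point v -> ~~ A a -> uniq [:: a; b; c; d] ->
  fin a c -> fin b d -> fin a d -> fin b c ->
  (v a c + v b d == v a d + v b c) = (A b ==> (gromov v b c == gromov v b d)).
Proof.
move=> v4 Aa; rewrite uniq4 => /and5P[ab ac ad bc /andP[bd cd]] fac fbd fad fbc.
have Ac := outside_A v4 Aa ac fac; have Ad := outside_A v4 Aa ad fad.
have ea := outside_shift v4 Aa Ac Ad cd fac fad.
have [Ab|Ab] /= := boolP (A b); last first.
  have eb := outside_shift v4 Ab Ac Ad cd fbc fbd.
  by apply/eqP; lra.
rewrite !gromov_finE // eqe; apply/eqP/eqP => e; lra.
Qed.

(** Degeneracy is thus read off comparisons of [gromov] at a common point, which are what
    [ultra_code] determines. If the products at [a] differ, the isosceles property at [a] and [b]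
    gives the second alternative. *)
Lemma degenerate_inside v a b c d : four_point v -> A a -> A b -> A c -> A d ->
  uniq [:: a; b; c; d] -> fin a c -> fin b d -> fin a d -> fin b c ->
  (v a c + v b d == v a d + v b c) =
    (gromov v a c == gromov v a d) && (gromov v b c == gromov v b d) ||
    (gromov v c a == gromov v c b) && (gromov v d a == gromov v d b).
Proof.
move=> v4 Aa Ab Ac Ad; rewrite uniq4 => /and5P[ab ac ad bc /andP[bd cd]] fac fbd fad fbc.
have gU := gromov_ultra v4.
have iso x c' d' : A x -> A c' -> A d' -> x != c' -> x != d' -> c' != d' ->
    (gromov v x c' < gromov v x d')%O -> gromov v c' d' = gromov v x c'.
  by move=> Ax Ac' Ad' xc xd cd' lt_g; apply: (isosceles gU); rewrite // uniq3 xc xd.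
have dc : d != c by rewrite eq_sym.
have := (iso _ _ _ Aa Ac Ad ac ad cd, iso _ _ _ Ab Ac Ad bc bd cd,
         (iso _ _ _ Aa Ad Ac ad ac dc, iso _ _ _ Ab Ad Ac bd bc dc)).
rewrite !(gU.1 _ a) !(gU.1 _ b) (gU.1 d c).
rewrite (gromov_finE v fac) (gromov_finE v fad) (gromov_finE v fbc) (gromov_finE v fbd) !lte_fin.
set ac' := _ - _ - v z c; set ad' := v a d - _ - _.
set bc' := v b c - _ - _; set bd' := v b d - _ - _.
move=> [[Hac Hbc] [Had Hbd]]; rewrite !eqe.
have -> : (v a c + v b d == v a d + v b c) = (ac' + bd' == ad' + bc').
  by rewrite /ac' /ad' /bc' /bd'; apply/eqP/eqP => e; lra.
apply/eqP/orP => [e|[|]/andP[/eqP e1 /eqP e2]]; [|lra..].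
case: (ltgtP ac' ad') => [lt_a|lt_a|e1].
- have lt_b : bc' < bd' by lra.
  right; have [e1] : ac'%:E = bc'%:E by rewrite -Hac // Hbc.
  by apply/andP; split; apply/eqP; lra.
- have lt_b : bd' < bc' by lra.
  right; have [e1] : ad'%:E = bd'%:E by rewrite -Had // Hbd.
  by apply/andP; split; apply/eqP; lra.
- by left; rewrite /=; apply/eqP; lra.
Qed.

Lemma degenerate_code v v' a b c d : four_point v -> four_point v' ->
  ultra_code A (gromov v) = ultra_code A (gromov v') ->
  degenerate v a b c d = degenerate v' a b c d.
Proof.
move=> v4 v4' /(ultra_code_inj (gromov_ultra v4) (gromov_ultra v4')) le_g.
have eq_g x y1 y2 : A x -> A y1 -> A y2 -> uniq [:: x; y1; y2] ->
    (gromov v x y1 == gromov v x y2) = (gromov v' x y1 == gromov v' x y2).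
  move=> Ax A1 A2; rewrite uniq3 => /and3P[n1 n2 n12]; rewrite !eq_le.
  by rewrite !le_g // uniq3 ?n1 ?n2 ?n12 // eq_sym n12.
have [abcd|nabcd] := boolP (uniq [:: a; b; c; d]); last by rewrite /degenerate (negbTE nabcd).
rewrite /degenerate abcd /=.
have [fac|//] := boolP (fin a c); have [fbd|//] := boolP (fin b d).
have [fad|//] := boolP (fin a d); have [fbc|//] := boolP (fin b c).
(* The symmetries of the equation move a point outside [A] to the first place. *)
have sym w a' b' c' d' : (w a' c' + w b' d' == w a' d' + w b' c' :> R) =
    (w b' c' + w a' d' == w b' d' + w a' c').
  by apply/eqP/eqP => e; lra.
have flip w : four_point w -> (w a c + w b d == w a d + w b c) = (w c a + w d b == w c b + w d a).
  by move=> [wC _]; rewrite !(wC _ a) !(wC _ b) (addrC (w b c)).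
have outside a' b' c' d' : ~~ A a' -> uniq [:: a'; b'; c'; d'] ->
    fin a' c' -> fin b' d' -> fin a' d' -> fin b' c' ->
    (v a' c' + v b' d' == v a' d' + v b' c') = (v' a' c' + v' b' d' == v' a' d' + v' b' c').
  move=> Aa u' f1 f2 f3 f4; rewrite !degenerate_outside //.
  have [Ab /=|//] := boolP (A b'); move: u'.
  rewrite uniq4 => /and5P[ab ac ad bc /andP[bd cd]].
  by apply: eq_g; rewrite ?(outside_A v4 Aa ac f1) ?(outside_A v4 Aa ad f3) // uniq3 bc bd.
move: (abcd); rewrite uniq4 => /and5P[ab ac ad bc /andP[bd cd]].
have [ba [ca [da [cb [db dc]]]]] : b != a /\ c != a /\ d != a /\ c != b /\ d != b /\ d != c.
  by rewrite (eq_sym b a) (eq_sym c a) (eq_sym d a) (eq_sym c b) (eq_sym d b) (eq_sym d c).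
have [Aa|Aa] := boolP (A a); last by apply: outside.
have [Ab|Ab] := boolP (A b); last first.
  by rewrite sym [RHS]sym; apply: outside; rewrite // uniq4 ba bc bd ac ad cd.
have [Ac|Ac] := boolP (A c); last first.
  by rewrite !flip //; apply: outside; rewrite 1?finC // uniq4 cd ca cb da db ab.
have [Ad|Ad] := boolP (A d); last first.
  rewrite !flip // sym [RHS]sym; apply: outside; rewrite 1?finC //.
  by rewrite uniq4 dc da db ca cb ab.
by rewrite !degenerate_inside // !eq_g // uniq3 ?ac ?ad ?bc ?bd ?ca ?cb ?da ?db ?ab ?cd.
Qed.

(** A solution [u] of the equations is fixed by [2 * m] coordinates: the pair of each point with [z]
    (with [o] outside [A]), and its pair with one nearest predecessor. Points are added one by one,
    each further pair being forced by a single equation. *)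
Lemma degenerate_determines v : four_point v ->
  exists p1 p2 : 'I_m -> 'I_m, forall u, (forall a b, u a b = u b a) ->
    (forall a b c d, degenerate v a b c d -> u a c + u b d = u a d + u b c) ->
    (forall x, u x (p1 x) = 0) -> (forall x, u x (p2 x) = 0) ->
    forall a b, a != b -> fin a b -> u a b = 0.
Proof.
move=> v4; have [vC _] := v4; have gU := gromov_ultra v4.
pose g := gromov v.
pose p1 x := if A x then z else o.
(* Without a nearest predecessor, the default only fixes a diagonal value, which the conclusion does
   not mention. *)
pose p2 x := if [pick y | nearest A g x y] is Some y then y else x.
exists p1, p2 => u uC u_eq u1 u2.
have uz x : A x -> u x z = 0 by move=> Ax; have := u1 x; rewrite /p1 Ax.
have uo x : ~~ A x -> u x o = 0 by move=> Ax; have := u1 x; rewrite /p1 (negbTE Ax).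
have uA k : forall x y, A x -> A y -> (y < x)%N -> (x < k)%N -> fin x y -> u x y = 0.
  elim: k => [//|k IHk] x y Ax Ay yx; rewrite ltnS => xk fxy.
  have [e Ne ue] : exists2 e, nearest A g x e & u x e = 0.
    have := u2 x; rewrite /p2; case: pickP => [e Ne ue|no _]; first by exists e.
    case: (@Order.TotalTheory.arg_maxP _ _ _ y (fun y => A y && (y < x)%N) (g x)).
      by rewrite Ay.
    move=> e /andP[Ae ex] He; have := no e; rewrite /nearest Ae ex /=.
    by move/negP; case; apply/forallP => y'; apply/implyP; apply: He.
  have [->//|ye] := eqVneq y e.
  have [Ae ex _] := nearestP _ _ _ _ Ne.
  (* If [y] ties with [e], the quartet [x z y e] is degenerate and transfers the zero from
     [u x e]. *)
  have [Ny|Ny] := boolP (nearest A g x y).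
    have eg := nearest_eq Ny Ne.
    have fxe : fin x e by move: eg; rewrite /g /gromov fxy; case: ifP.
    move: eg; rewrite /g !gromov_finE // => -[eg].
    have [/andP[yz fzy] /andP[ez fze]] := (Ay, Ae).
    have [xz _] := andP Ax.
    have [xy xe] : x != y /\ x != e by rewrite -!val_eqE /= !gtn_eqF.
    have deg : degenerate v x z y e.
      rewrite /degenerate uniq4 xz xy xe ye fxy fze fxe fzy (eq_sym z y) yz (eq_sym z e) ez.
      by apply/eqP; lra.
    by have := u_eq _ _ _ _ deg; rewrite (uC z e) (uC z y) !uz // ue !addr0.
  (* If [y] is not nearest, the quartet [y z e x] is degenerate and transfers the zero from the
     earlier pair [y e]. *)
  have eg := not_nearest_dist gU Ax Ne Ay yx Ny.
  have fye : fin y e.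
    by move: (not_nearest_lt Ne Ay yx Ny); rewrite /g -eg /gromov; case: (fin y e); rewrite // ltNge leey.
  have lt_k w w' : A w -> A w' -> (w < x)%N -> (w' < x)%N -> w != w' -> fin w w' -> u w w' = 0.
    move=> Aw Aw' wx w'x; rewrite -val_eqE neq_ltn => /orP[lt_w|lt_w] fw.
      by rewrite uC; apply: IHk; rewrite // 1?finC // (leq_trans w'x).
    by apply: IHk => //; apply: leq_trans xk.
  have uye := lt_k y e Ay Ae yx ex ye fye.
  move: eg; rewrite /g !gromov_finE // => -[eg].
  have [/andP[yz fzy] /andP[ez fze]] := (Ay, Ae); have [xz fzx] := andP Ax.
  have [yx' ex'] : y != x /\ e != x by rewrite -!val_eqE /= !ltn_eqF.
  have deg : degenerate v y z e x.
    rewrite /degenerate uniq4 yz ye yx' ex' (eq_sym z e) ez (eq_sym z x) xz fye fzx (finC y) fxy fze.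
    by apply/eqP; rewrite (vC y x); lra.
  by have := u_eq _ _ _ _ deg; rewrite (uC z e) (uC z x) !uz // uye (uC y x) !addr0.
have uAA x y : A x -> A y -> x != y -> fin x y -> u x y = 0.
  move=> Ax Ay; rewrite -val_eqE neq_ltn => /orP[xy|yx] fxy; last exact: (uA m).
  by rewrite uC; apply: (uA m); rewrite // finC.
have uz' x : x != z -> fin x z -> u x z = 0.
  by move=> xz fxz; apply: uz; rewrite /A xz finC.
have uout x y : ~~ A x -> x != z -> x != y -> fin x y -> u x y = 0.
  move=> Ax xz xy fxy; have Ay := outside_A v4 Ax xy fxy.
  have [->|yo] := eqVneq y o; first exact: uo.
  have fzx : fin z x = false by move: Ax; rewrite negb_and negbK (negbTE xz) => /negbTE.
  have xo : x != o by apply: contraNneq Ax => ->; apply: base_A.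
  have [yz fzy] := andP Ay.
  have fxo : fin x o.
    have := v4.2 x y z o; rewrite uniq4 xy xz xo yz yo zo => /(_ isT fxy fzo).
    by rewrite (finC x z) fzx /= => /and3P[].
  have deg : degenerate v x z y o.
    rewrite /degenerate uniq4 xy xz xo yo zo fxy fzo fxo fzy (eq_sym z y) yz.
    by apply/eqP/(outside_shift v4 Ax Ay base_A yo fxy fxo).
  by have := u_eq _ _ _ _ deg; rewrite (uC z o) (uC z y) !uz ?base_A // uo // !addr0.
move=> a b ab fab.
have [ea|az] := eqVneq a z; first by rewrite ea uC; apply: uz'; rewrite -ea 1?finC // eq_sym.
have [eb|bz] := eqVneq b z; first by rewrite eb; apply: uz'; rewrite -eb.
have [Aa|Aa] := boolP (A a); last exact: uout.
have [Ab|Ab] := boolP (A b); first exact: uAA.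
by rewrite uC; apply: uout; rewrite // 1?eq_sym 1?finC.
Qed.

End Based.

Lemma degenerate_code_exists :
  exists code : ('I_m -> 'I_m -> R) -> {ffun 'I_m -> 'I_m * bool * bool},
    forall v v', four_point v -> four_point v' -> code v = code v' ->
      forall a b c d, degenerate v a b c d = degenerate v' a b c d.
Proof.
have [/existsP[z /existsP[ o /andP[zo fzo]]]|no] := boolP [exists z, exists o, (z != o) && fin z o].
  exists (fun v => ultra_code (fun a => (a != z) && fin z a) (gromov z v)) => v v' v4 v4' vv' a b c d.
  exact: (degenerate_code zo fzo).
(* With no basis pair nothing is degenerate, so a constant code serves. *)
exists (fun _ => [ffun x => (x, false, false)]) => v v' _ _ _ a b c d.
rewrite /degenerate uniq4; have [ac /=|ac] := eqVneq a c; first by rewrite !andbF.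
have [fac|_] := boolP (fin a c); last by rewrite !andbF.
by case/negP: no; apply/existsP; exists a; apply/existsP; exists c; rewrite ac.
Qed.

Lemma degenerate_basis v : four_point v ->
  exists p1 p2 : 'I_m -> 'I_m, forall u, (forall a b, u a b = u b a) ->
    (forall a b c d, degenerate v a b c d -> u a c + u b d = u a d + u b c) ->
    (forall x, u x (p1 x) = 0) -> (forall x, u x (p2 x) = 0) ->
    forall a b, a != b -> fin a b -> u a b = 0.
Proof.
move=> v4.
have [/existsP[z /existsP[ o /andP[zo fzo]]]|no] := boolP [exists z, exists o, (z != o) && fin z o].
  exact: (degenerate_determines zo fzo v4).
exists id, id => u _ _ _ _ a b ab fab.
by case/negP: no; apply/existsP; exists a; apply/existsP; exists b; rewrite ab.
Qed.
End FourPoint.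

(** * Spans of linear forms *)

Section LinearForms.
Local Open Scope set_scope.
Variables (F : fieldType) (N : nat) (Q : finType) (form : Q -> 'rV[F]_N).
Implicit Types (A B G : {set Q}) (K C P : {set 'I_N}).

Definition form_span A : 'M[F]_N := (\sum_(x in A) <<form x>>)%MS.

Lemma mem_form_span x A : x \in A -> (form x <= form_span A)%MS.
Proof. by move=> xA; apply: (sumsmx_sup x); rewrite ?genmxE. Qed.

Lemma form_span_sub A (X : 'M[F]_N) :
  (forall x, x \in A -> (form x <= X)%MS) -> (form_span A <= X)%MS.
Proof. by move=> AX; apply/sumsmx_subP => x xA; rewrite genmxE AX. Qed.

Lemma form_spanS A B : A \subset B -> (form_span A <= form_span B)%MS.
Proof. by move=> /fintype.subsetP AB; apply: form_span_sub => x /AB; apply: mem_form_span. Qed.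

(** Duality between a row space and its solutions, tested on the columns of [cokermx X]. *)
Lemma sub_by_solutions (p q : nat) (X : 'M[F]_(q, N)) (V : 'M[F]_(p, N)) :
  (forall u : 'cV[F]_N, X *m u = 0 -> V *m u = 0) -> (V <= X)%MS.
Proof.
move=> VX; rewrite submxE; apply/eqP/matrixP => i j.
have Xj : X *m (cokermx X *m delta_mx j (0 : 'I_1)) = 0 by rewrite mulmxA mulmx_coker mul0mx.
by have := VX _ Xj; rewrite mulmxA -colE => /matrixP/(_ i 0); rewrite !mxE.
Qed.

Lemma mulmx_sub0 (p q : nat) (X : 'M[F]_(q, N)) (V : 'M[F]_(p, N)) (u : 'cV[F]_N) :
  (V <= X)%MS -> X *m u = 0 -> V *m u = 0.
Proof. by move=> /submxP[D ->] Xu; rewrite -mulmxA Xu mulmx0. Qed.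

Definition coord_mx K : 'M[F]_(#|K|, N) := rowsub (enum_val : 'I_#|K| -> 'I_N) 1%:M.

Lemma rank_coord_mx K : \rank (coord_mx K) = #|K|.
Proof.
apply/eqP; rewrite -/(row_free _); apply/row_freeP; exists (coord_mx K)^T.
apply/matrixP => i j; rewrite !mxE (bigD1 (enum_val i)) //= !mxE eqxx mul1r.
rewrite big1 => [|k /negbTE ki]; last by rewrite !mxE eq_sym ki mul0r.
by rewrite addr0 (inj_eq enum_val_inj) eq_sym.
Qed.

Lemma coord_mx_out K (v : 'rV[F]_N) i : (v <= coord_mx K)%MS -> i \notin K -> v 0 i = 0.
Proof.
move=> /submxP[w ->] iK; rewrite mxE big1 // => k _; rewrite !mxE.
have [ki|_] := eqVneq (enum_val k) i; last by rewrite mulr0.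
by move: iK; rewrite -ki enum_valP.
Qed.

Lemma mul_coord_mx K (u : 'cV[F]_N) : (coord_mx K *m u == 0) = [forall i in K, u i 0 == 0].
Proof.
have E : coord_mx K *m u = rowsub enum_val u by rewrite -[in RHS](mul1mx u) mul_rowsub_mx.
rewrite E; apply/eqP/forall_inP => [u0 i iK|u0].
  have := congr1 (fun w : 'cV[F]_ _ => w (enum_rank_in iK i) 0) u0.
  by rewrite !mxE enum_rankK_in // => ->.
by apply/colP => k; rewrite !mxE; apply/eqP/u0/enum_valP.
Qed.

(** [K] is the complement of a column basis of [X]: its coordinates are independent functionals on
    the solutions of [X *m u = 0], as many as the dimension. *)
Lemma free_coordinates (X : 'M[F]_N) : exists K, #|K| = (N - \rank X)%N /\
  (X :&: coord_mx K)%MS = 0.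
Proof.
pose f := maxrankfun X^T; exists (~: [set f i | i in 'I_(\rank X^T)]); split.
  by rewrite cardsCs finset.setCK card_imset ?card_ord ?mxrank_tr //; apply: maxrankfun_inj.
apply/eqP/rowV0P => v; rewrite sub_capmx => /andP[/submxP[w vE] vK].
have /submxP[D XE] : (X^T <= rowsub f X^T)%MS by rewrite eq_maxrowsub.
suff : v^T = 0 by move/(congr1 trmx); rewrite trmxK trmx0.
have X0 : rowsub f X^T *m w^T = 0.
  rewrite mul_rowsub_mx -trmx_mul -vE; apply/matrixP => i j; rewrite !mxE.
  by rewrite [j]ord1; apply: coord_mx_out vK _; rewrite inE negbK imset_f.
by rewrite vE trmx_mul XE -mulmxA X0 mulmx0.
Qed.

(** The coordinates in [K :&: C] are independent modulo [X], yet modulo [Y] they lie in the span of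
    the coordinates in [P]. *)
Lemma rank_gain (X Y : 'M[F]_N) K C P : (X :&: coord_mx K)%MS = 0 ->
  (forall u : 'cV[F]_N, Y *m u = 0 -> (forall i, i \in P -> u i 0 = 0) ->
     forall i, i \in C -> u i 0 = 0) ->
  (\rank X + #|K :&: C| <= \rank (X + Y)%MS + #|P|)%N.
Proof.
move=> XK YP.
have subK : (coord_mx (K :&: C) <= coord_mx K)%MS.
  apply/row_subP => i; rewrite row_rowsub.
  have iK : enum_val i \in K by have := enum_valP i; rewrite inE => /andP[].
  apply: submx_trans (row_sub (enum_rank_in iK (enum_val i)) (coord_mx K)).
  by rewrite row_rowsub enum_rankK_in.
have subC : (coord_mx (K :&: C) <= Y + coord_mx P)%MS.
  apply: sub_by_solutions => u u0; apply/eqP; rewrite mul_coord_mx.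
  have Pu0 := mulmx_sub0 (addsmxSr Y (coord_mx P)) u0.
  apply/forall_inP => i; rewrite inE => /andP[_ iC]; apply/eqP.
  apply: (YP u) => //; first exact: mulmx_sub0 (addsmxSl _ _) u0.
  by move/eqP: Pu0; rewrite mul_coord_mx => /forall_inP Pu0 k /Pu0/eqP.
rewrite -(rank_coord_mx (K :&: C)) -mxrank_disjoint_sum; last first.
  by apply/eqP; rewrite -submx0 -XK capmxS.
rewrite -(rank_coord_mx P); apply: leq_trans (mxrank_adds_leqif _ _).
apply: mxrankS; rewrite -addsmxA addsmxS //.
Qed.

End LinearForms.

(** * Revealing equations block by block *)

Section GreedyRevealing.
Local Open Scope set_scope.
Variables (R : realType) (N : nat) (Q J : finType) (form : Q -> 'rV[R]_N).

(** Exponential weighting: give [G] the weight [y ^+ #|G|] with [y = expR (- L)]. The total is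
    [(y + 1) ^+ #|Q|], and each small set weighs at least [y ^+ s]. *)
Lemma card_small_sets (L : R) (s : nat) : 0 <= L ->
  #|[set G : {set Q} | (#|G| <= s)%N]|%:R <= expR (expR (- L) * #|Q|%:R + L * s%:R).
Proof.
move=> L0; set y := expR (- L); have y0 : 0 < y by apply: expR_gt0.
have y1 : y <= 1 by rewrite /y -expR0 ler_expR oppr_le0.
have : (\sum_(G : {set Q}) y ^+ #|G|) <= expR (y * #|Q|%:R).
  have -> : \sum_(G : {set Q}) y ^+ #|G| = (y + 1) ^+ #|Q|.
    have := @bigA_distr R 0 1 *%R +%R Q (fun _ => y) (fun _ => 1).
    rewrite prodr_const cardT -cardE => ->; apply: eq_bigr => G _.
    by rewrite -big_mkcond prodr_const.
  have le_y : y + 1 <= expR y by rewrite addrC expR_ge1Dx.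
  by rewrite expRM_natr lerXn2r ?nnegrE ?expR_ge0 // addr_ge0 // ltW.
move=> le_sum; rewrite expRD.
have -> : expR (L * s%:R) = (y ^+ s)^-1.
  by rewrite /y -expRM_natr mulNr expRN invrK.
rewrite ler_pdivlMr ?exprn_gt0 //; apply: le_trans le_sum.
rewrite (bigID (fun G : {set Q} => (#|G| <= s)%N)) /=.
apply: (@le_trans _ _ (\sum_(G : {set Q} | (#|G| <= s)%N) y ^+ s)).
  by rewrite sumr_const mulr_natl cardsE.
apply: ler_wpDr; first by apply: sumr_ge0 => G _; rewrite exprn_ge0 // ltW.
by apply: ler_sum => G Gs; apply: ler_wiXn2l; rewrite // ltW.
Qed.

Local Notation span := (form_span form).

Lemma span_extension (A0 A : {set Q}) : A0 \subset A ->
  exists G : {set Q}, [/\ G \subset A, (#|G| <= N - \rank (span A0))%N &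
    (span A <= span (A0 :|: G))%MS].
Proof.
have [k] := ubnP (N - \rank (span A0))%N.
elim: k A0 => [//|k IHk] A0 le_k A0A.
have [le_span|] := boolP (span A <= span A0)%MS.
  by exists finset.set0; rewrite finset.sub0set cards0 finset.setU0.
have [/forall_inP all_in|/forall_inPn[x xA xN]] := boolP [forall x in A, (form x <= span A0)%MS].
  by move/negP; case; apply: form_span_sub.
move=> _; set A1 := x |: A0.
have lt_rank : (\rank (span A0) < \rank (span A1))%N.
  rewrite (ltn_leqif (mxrank_leqif_sup _)); last by apply: form_spanS; apply: finset.subsetUr.
  by apply: contra xN; apply: submx_trans; apply: mem_form_span; rewrite !inE eqxx.
have rankN := rank_leq_col (span A1).
have [||G [GA Gk spanG]] := IHk A1.
- lia.
- by rewrite finset.subUset finset.sub1set xA.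
exists (x |: G); split.
- by rewrite finset.subUset finset.sub1set xA.
- by rewrite cardsU1; apply: leq_trans (leq_add (leq_b1 _) Gk) _; lia.
- by rewrite finset.setUCA finset.setUA.
Qed.

Variables (valid : pred Q) (classes : {set {set Q}}).
(** [T] bounds the traces of classes on a block, [q] the coordinates left free by its equations, and
    [t] from below the blocks through a coordinate; on average a block covers a share of at least
    [D / n] of any set of coordinates. Later [n] becomes the number of r-sets, not of points. *)
Variables (block : J -> {set Q}) (coords : J -> {set 'I_N}) (T q t D n : nat).
Hypotheses
  (classes_closed : forall A, A \in classes ->
     A = [set x | valid x & (form x <= span A)%MS])
  (block_count : forall j, (#|[set A :&: block j | A in classes]| <= T)%N)
  (block_rank : forall j A, A \in classes -> exists2 P : {set 'I_N}, (#|P| <= q)%N &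
     forall u : 'cV[R]_N, (forall x, x \in A :&: block j -> form x *m u = 0) ->
       (forall i, i \in P -> u i 0 = 0) -> forall i, i \in coords j -> u i 0 = 0)
  (coords_cover : forall i, (t <= #|[set j | i \in coords j]|)%N)
  (J_gt0 : (0 < #|J|)%N) (J_le : (#|J| * D <= t * n)%N) (n_gt0 : (0 < n)%N) (D_le : (D <= n)%N).

(** Double counting of the pairs of a coordinate in [K] and a block covering it. *)
Lemma heavy_block (K : {set 'I_N}) : exists j, (#|K| * D <= #|K :&: coords j| * n)%N.
Proof.
apply/existsP; apply: contraT; rewrite negb_exists => /forallP light.
have [j0 _] := card_gt0P J_gt0.
have lt_sum : (\sum_j #|K :&: coords j| * n < \sum_(j : J) #|K| * D)%N.
  rewrite (bigD1 j0) // [leqRHS](bigD1 j0) //= -addSn; apply: leq_add.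
    by have := light j0; rewrite -ltnNge.
  by apply: leq_sum => j _; apply: ltnW; have := light j; rewrite -ltnNge.
move: lt_sum; rewrite sum_nat_const ltnNge => /negP; case.
apply: (@leq_trans (#|K| * t * n)); first by rewrite mulnCA -mulnA leq_mul2l J_le orbT.
rewrite -big_distrl leq_mul2r; apply/orP; right.
under eq_bigr => j _ do rewrite -sum1_card.
rewrite (exchange_big_dep (mem K)) /= => [|j i _]; last by rewrite inE => /andP[].
rewrite -sum_nat_const; apply: leq_sum => i iK.
apply: leq_trans (coords_cover i) _; rewrite -sum1_card.
by apply/eq_leq/eq_bigl => j; rewrite !inE iK.
Qed.

(* Bounds the dimension of the solution space of the known equations after those of a
   heavy block have been revealed, if it was at most [x] before. *)
Definition dim_step (x : R) := (1 - D%:R / n%:R) * x + q%:R.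

(* While a step remains, reveal a block that is heavy for a basis [K] of the solution
   space, at the cost of a factor [T]; finally, [A] is the closure of the known equations
   and at most as many further ones as the dimension of their solution space. *)
Lemma greedy_count (L : R) (k : nat) (A0 : {set Q}) (Y : {set {set Q}}) (x : R) : 0 <= L ->
  Y \subset classes -> (forall A, A \in Y -> A0 \subset A) ->
  (N - \rank (span A0))%:R <= x ->
  #|Y|%:R <= T%:R ^+ k * expR (expR (- L) * #|Q|%:R + L * iter k dim_step x).
Proof.
move=> L0; elim: k A0 Y x => [|k IHk] A0 Y x /fintype.subsetP sYC YA0 le_x.
  rewrite expr0 mul1r /=.
  apply: (@le_trans _ _ #|[set G : {set Q} | (#|G| <= N - \rank (span A0))%N]|%:R); last first.
    by apply: le_trans (card_small_sets _ L0) _; rewrite ler_expR lerD2l ler_wpM2l.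
  rewrite ler_nat.
  pose ext (A : {set Q}) : {set Q} := odflt finset.set0 [pick G : {set Q} |
    [&& G \subset A, (#|G| <= N - \rank (span A0))%N & (span A <= span (A0 :|: G))%MS]].
  have extP A : A \in Y -> [/\ ext A \subset A, (#|ext A| <= N - \rank (span A0))%N &
      (span A <= span (A0 :|: ext A))%MS].
    move=> AY; rewrite /ext; case: pickP => [G /and3P//|no].
    have [G [G1 G2 G3]] := span_extension (YA0 _ AY).
    by have := no G; rewrite G1 G2 G3.
  have ext_span A : A \in Y -> (span (A0 :|: ext A) :=: span A)%MS.
    move=> AY; have [sA _ le_s] := extP A AY; apply/eqmxP; rewrite le_s andbT.
    by apply: form_spanS; rewrite finset.subUset YA0.
  have ext_inj : {in Y &, injective ext}.
    move=> A B AY BY eAB; rewrite (classes_closed (sYC _ AY)) (classes_closed (sYC _ BY)).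
    by apply/setP => z; rewrite !inE -(ext_span A) // -(ext_span B) // eAB.
  rewrite -(card_in_imset ext_inj); apply: subset_leq_card.
  by apply/fintype.subsetP => _ /imsetP[A AY ->]; rewrite inE; have [] := extP A AY.
have [K [cardK XK]] := free_coordinates (span A0).
have [j heavy] := heavy_block K.
set I := [set A :&: block j | A in classes].
rewrite exprS -mulrA iterSr.
(* [Y] splits into at most [T] fibres by the trace [B] on block [j]; the induction applies to each
   with [A0 :|: B] as known equations. *)
have -> : #|Y| = (\sum_(B in I) #|[set A in Y | A :&: block j == B]|)%N.
  rewrite -sum1_card (partition_big (fun A => A :&: block j) (mem I)) /=; last first.
    by move=> A /sYC AC; apply: imset_f.
  by apply: eq_bigr => B _; rewrite -sum1_card; apply: eq_bigl => A; rewrite !inE.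
rewrite natr_sum; set U := T%:R ^+ k * _.
apply: (@le_trans _ _ (\sum_(B in I) U)); last first.
  rewrite sumr_const -[leLHS]mulr_natl ler_wpM2r ?ler_nat ?block_count //.
  by rewrite mulr_ge0 ?exprn_ge0 ?expR_ge0.
apply: ler_sum => B _; set Z := [set A in Y | _].
have [->|[A AZ]] := set_0Vmem Z; first by rewrite cards0 mulr_ge0 ?exprn_ge0 ?expR_ge0.
have [AY /eqP AB] : A \in Y /\ A :&: block j == B by move: AZ; rewrite inE => /andP[].
apply: (IHk (A0 :|: B) Z).
- by apply/fintype.subsetP => A'; rewrite inE => /andP[/sYC].
- move=> A'; rewrite inE => /andP[A'Y /eqP <-].
  by rewrite finset.subUset YA0 // finset.subsetIl.
have [P cardP PP] := block_rank j (sYC _ AY).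
have gain : (\rank (span A0) + #|K :&: coords j| <= \rank (span A0 + span B)%MS + #|P|)%N.
  apply: rank_gain => // u Bu u0; apply: PP => // z; rewrite AB => zB.
  exact: mulmx_sub0 (mem_form_span form zB) Bu.
have le_rank : (\rank (span A0 + span B)%MS <= \rank (span (A0 :|: B)))%N.
  by apply: mxrankS; rewrite addsmx_sub !form_spanS // ?finset.subsetUl ?finset.subsetUr.
have le_dim : (N - \rank (span (A0 :|: B)) + #|K :&: coords j| <= #|K| + q)%N.
  by rewrite cardK; have := rank_leq_col (span A0); have := rank_leq_col (span (A0 :|: B)); lia.
have n0 : (0 : R) < n%:R by rewrite ltr0n.
have heavyR : #|K|%:R * (D%:R / n%:R) <= #|K :&: coords j|%:R :> R.
  by rewrite mulrA ler_pdivrMr // -!natrM ler_nat.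
move: le_dim; rewrite -(ler_nat R) !natrD => le_dim.
rewrite /dim_step; apply: (@le_trans _ _ ((1 - D%:R / n%:R) * #|K|%:R + q%:R)); first lra.
rewrite lerD2r ler_wpM2l // ?cardK // subr_ge0 ler_pdivrMr // mul1r ler_nat //.
Qed.

End GreedyRevealing.

(** * Cells of the fan *)

(* The blocks of a system are the families [S + {a, b}] for a fixed [S] of size
   [r - 2], or dually [U - {a, b}] for a fixed [U] of size [r + 2]. *)
Record block_system (E J : finType) (m r t : nat)
    (beta : J -> 'I_m -> 'I_m -> {set E}) : Prop := BlockSystem {
  block_sym : forall j a b, beta j a b = beta j b a;
  block_card : forall j a b, a != b -> #|beta j a b| = r;
  block_exchange : forall j a b c d, uniq [:: a; b; c; d] ->
    exists2 e, e \in beta j a b :\: beta j c d &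
      forall f, f \in beta j c d :\: beta j a b ->
        (f |: (beta j a b :\ e), (e |: beta j c d) :\ f)%SET \in
          [:: (beta j a c, beta j b d); (beta j b d, beta j a c);
              (beta j a d, beta j b c); (beta j b c, beta j a d)];
  block_cover : forall B : {set E}, #|B| = r ->
    (t <= #|[set j | [exists a, exists b, (a != b) && (B == beta j a b)]]%SET|)%N;
  block_quartet : forall (S : {set E}) a b c d, #|S|.+2 = r -> uniq [:: a; b; c; d] ->
    all (fun x => x \notin S) [:: a; b; c; d] ->
    exists j a' b' c' d', uniq [:: a'; b'; c'; d'] /\
      [/\ beta j a' c' = add_pair S a c, beta j b' d' = add_pair S b d,
          beta j a' d' = add_pair S a d & beta j b' c' = add_pair S b c] }.

Section CountingCells.
Import numFieldNormedType.Exports.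
Local Open Scope set_scope.
Variables (R : realType) (E : finType) (M : matroid E).
Implicit Types (nu : basis_space R M) (B : {set E}).

(** The value of [f] determines the combinatorial class and hence its closure, so the cells lie in
    the image of a finite set. *)
Lemma num_cells_le (X : finType) (f : basis_space R M -> X) :
  (forall nu nu', valuation nu -> valuation nu' -> f nu = f nu' ->
     degenerate_triples nu = degenerate_triples nu') ->
  finite_set (fan_cells R M) /\
  (num_cells R M <= #|[set x | `[< exists2 nu, valuation nu & f nu = x >]]|)%N.
Proof.
move=> f_det; set Y := [set x | _].
pose cell x : set (basis_space R M) :=
  closure [set nu | exists nu', [/\ valuation nu', f nu' = x & comb_class nu' nu]]%classic.
pose Yf := [fset x in Y]%fset.
have sub : (fan_cells R M `<=` cell @` [set` Yf])%classic.
  move=> C [nu vnu ->]; exists (f nu); first by rewrite /= !inE; exists nu.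
  congr closure; apply/seteqP; split => [nu1 [nu2 [v2 f2 [v1 e12]]]|nu1 nu_nu1].
    by split=> //; rewrite /comb_equiv (f_det nu nu2).
  by exists nu.
have fin_img : finite_set (cell @` [set` Yf])%classic by apply: finite_image; apply: finite_fset.
have fin_cells := sub_finite_set sub fin_img; split=> //.
rewrite /num_cells; apply: leq_trans (_ : #|` fset_set (cell @` [set` Yf])%classic| <= _)%N.
  by apply: fsubset_leq_card; rewrite -fset_set_sub.
rewrite fset_set_image; last exact: finite_fset.
by rewrite set_fsetK; apply: leq_trans (leq_imfset_card _ _ _) _; rewrite -card_finset.
Qed.

(** [fine] gives the placeholder 0 off the bases. *)
Let weight nu B := fine (extend nu B).

Lemma extendE nu B : extend nu B = if B \in bases M then (weight nu B)%:E else +oo%E.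
Proof. by rewrite /weight /extend; case: insubP => [b -> _|/negbTE ->]. Qed.

Lemma extend_base nu B : B \in bases M -> extend nu B = (weight nu B)%:E.
Proof. by rewrite extendE => ->. Qed.

Variables (J : finType) (m r t : nat) (beta : J -> 'I_m -> 'I_m -> {set E}).
Hypotheses (rankM : mrank M = r) (sysB : block_system r t beta).

Let fin j : rel 'I_m := fun a b => beta j a b \in bases M.
Let w nu j a b := weight nu (beta j a b).

Lemma fin_sym j : symmetric (fin j).
Proof. by move=> a b; rewrite /fin (block_sym sysB). Qed.

(** At the element [e] of [block_exchange], every admissible [f] re-pairs [ab, cd] as [ac, bd] or
    [ad, bc], so the valuation axiom there is the four-point condition. *)
Lemma valuation_four_point nu j : valuation nu -> four_point (fin j) (w nu j).
Proof.
move=> vnu; split=> [a b|a b c d abcd fab fcd]; first by rewrite /w (block_sym sysB).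
move: (abcd); rewrite uniq4 => /and5P[ab _ _ _ /andP[_ cd]].
have [e eD HeD] := block_exchange sysB j abcd.
have [f fD] := vnu _ _ (etrans (block_card sysB j ab) (esym rankM))
  (etrans (block_card sysB j cd) (esym rankM)) e eD.
rewrite (extend_base nu fab) (extend_base nu fcd) -EFinD.
have := HeD f fD; rewrite !inE => /or4P[] /eqP[-> ->]; rewrite !extendE /fin /w;
  do 2 case: ifP => //; rewrite -EFinD lee_fin => f1 f2 le_w; apply/orP.
- by left; apply/and3P.
- by left; apply/and3P; split; rewrite // addrC.
- by right; apply/and3P.
- by right; apply/and3P; split; rewrite // addrC.
Qed.

Let Q : finType := (J * ('I_m * 'I_m * 'I_m * 'I_m))%type.
Let N := #|bases M|.

(* Unlike [degenerate_triples], this ignores the equalities between infinite sums, which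
   depend only on the matroid. *)
Definition equations nu : {set Q} :=
  [set x : Q | let: (j, (a, b, c, d)) := x in degenerate (fin j) (w nu j) a b c d].

(** Each triple is realized in some block. If one of its four sets is not a basis, whether the
    equality holds depends on [M] alone; otherwise it is recorded in [equations]. *)
Lemma equations_determine nu nu' : equations nu = equations nu' ->
  degenerate_triples nu = degenerate_triples nu'.
Proof.
suff sub nu1 nu2 : equations nu1 = equations nu2 ->
    (degenerate_triples nu1 `<=` degenerate_triples nu2)%classic.
  by move=> e; apply/seteqP; split; apply: sub.
move=> e12 _ [S [a [b [c [d [cardS abcd notS -> eqS]]]]]].
exists S, a, b, c, d; split => //.
have [j [a' [b' [c' [d' [abcd' [eac ebd ead ebc]]]]]]] :=
  block_quartet sysB (etrans cardS rankM) abcd notS.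
move: eqS; rewrite -eac -ebd -ead -ebc !extendE.
have := congr1 (fun A : {set Q} => (j, (a', b', c', d')) \in A) e12.
rewrite /= !inE /degenerate abcd' /fin /w.
do 4 (case: ifP => //= _); rewrite -?EFinD.
by move=> ew [/eqP]; rewrite ew => /eqP ->.
Qed.

(** This is the zero vector when [B] is not a basis, so [equation_form] makes sense for every
    quadruple. *)
Let indicator B (i : 'I_N) : R := (enum_val i == B)%:R.
Let at_basis (u : 'cV[R]_N) B := \sum_i indicator B i * u i 0.

Definition equation_form (x : Q) : 'rV[R]_N := let: (j, (a, b, c, d)) := x in
  \row_i (indicator (beta j a c) i + indicator (beta j b d) i
          - indicator (beta j a d) i - indicator (beta j b c) i).

Lemma equation_formE (u : 'cV[R]_N) j a b c d : equation_form (j, (a, b, c, d)) *m u = 0 <->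
  at_basis u (beta j a c) + at_basis u (beta j b d) =
  at_basis u (beta j a d) + at_basis u (beta j b c).
Proof.
have formE : (equation_form (j, (a, b, c, d)) *m u) 0 0 =
    at_basis u (beta j a c) + at_basis u (beta j b d)
    - at_basis u (beta j a d) - at_basis u (beta j b c).
  rewrite mxE /at_basis -big_split -!sumrB /=; apply: eq_bigr => i _.
  by rewrite mxE !mulrDl !mulNr.
split=> [/matrixP/(_ 0 0)|e]; first by rewrite formE mxE => e; lra.
by apply/matrixP => i k; rewrite !ord1 formE mxE; lra.
Qed.

Lemma at_basisE (u : 'cV[R]_N) i : at_basis u (enum_val i) = u i 0.
Proof.
rewrite /at_basis (bigD1 i) //= /indicator eqxx mul1r big1 ?addr0 // => k ki.
by rewrite (inj_eq enum_val_inj) (negbTE ki) mul0r.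
Qed.

Lemma at_nonbasis (u : 'cV[R]_N) B : B \notin bases M -> at_basis u B = 0.
Proof.
move=> BM; rewrite /at_basis big1 // => i _; rewrite /indicator.
have [eB|_] := eqVneq (enum_val i) B; last by rewrite mul0r.
by rewrite -eB enum_valP in BM.
Qed.

Lemma basis_index B : B \in bases M -> exists i : 'I_N, enum_val i = B.
Proof. by move=> BM; exists (enum_rank_in BM B); rewrite enum_rankK_in. Qed.

Let weights nu : 'cV[R]_N := \col_i weight nu (enum_val i).

Lemma at_weights nu B : B \in bases M -> at_basis (weights nu) B = weight nu B.
Proof. by move=> /basis_index[i <-]; rewrite at_basisE mxE. Qed.

Let valid (x : Q) := let: (j, (a, b, c, d)) := x in
  [&& uniq [:: a; b; c; d], fin j a c, fin j b d, fin j a d & fin j b c].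

Lemma equation_weights nu j a b c d : valid (j, (a, b, c, d)) ->
  equation_form (j, (a, b, c, d)) *m weights nu = 0 <-> (j, (a, b, c, d)) \in equations nu.
Proof.
move=> /and5P[abcd fac fbd fad fbc]; rewrite equation_formE !at_weights //.
by rewrite inE /degenerate abcd fac fbd fad fbc; split=> /eqP.
Qed.

Lemma equations_valid nu x : x \in equations nu -> valid x.
Proof. by case: x => j [[[a b] c] d]; rewrite inE => /and5P[? ? ? ? /andP[? _]]; apply/and5P. Qed.

(** Every form in the span kills [weights nu], and a valid quadruple whose form kills [weights nu]
    is an equation of [nu]. *)
Lemma equations_closed nu : equations nu =
  [set x | valid x & (equation_form x <= form_span equation_form (equations nu))%MS].
Proof.
apply/setP => -[j [[[a b] c] d]]; rewrite [RHS]inE; apply/idP/andP => [xnu|[valid_x sub_x]].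
  by split; [apply: equations_valid xnu | apply: mem_form_span].
apply/(equation_weights nu valid_x); apply/sub_kermxP; apply: submx_trans sub_x _.
apply: form_span_sub => -[k [[[a' b'] c'] d']] y; apply/sub_kermxP.
by apply/equation_weights => //; apply: equations_valid y.
Qed.

Definition equation_classes : {set {set Q}} :=
  [set A | `[< exists2 nu, valuation nu & equations nu = A >]].

Definition block_equations j : {set Q} := [set x : Q | x.1 == j].

(** A trace on the block is recovered from the code of any valuation inducing it, and a code maps
    [m] points to [4 * m] values. *)
Lemma card_block_equations j :
  (#|[set A :&: block_equations j | A in equation_classes]| <= (4 * m) ^ m)%N.
Proof.
have [code codeP] := @degenerate_code_exists R m (fin j) (fin_sym j).
set I := [set _ | _ in _].
have repr (X : {set Q}) : exists nu, X \in I ->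
    valuation nu /\ equations nu :&: block_equations j = X.
  have [/imsetP[A]|_] := boolP (X \in I); last by exists (fun _ => 0).
  by rewrite inE => /asboolP[nu vnu <-] ->; exists nu.
have [rep repP] := choice repr.
have inj : {in I &, injective (fun X : {set Q} => code (w (rep X) j))}.
  move=> X X' XI X'I /= eq_code.
  have [v1 e1] := repP _ XI; have [v2 e2] := repP _ X'I.
  rewrite -e1 -e2; apply/setP => -[k [[[a b] c] d]]; rewrite !inE /=.
  have [->|//] := eqVneq k j; last by rewrite !andbF.
  by rewrite !andbT; apply: codeP => //; apply: valuation_four_point.
rewrite -(card_in_imset inj); apply: leq_trans (max_card _) _.
by rewrite card_ffun !card_prod !card_bool !card_ord -mulnA mulnC.
Qed.

Definition block_coords j : {set 'I_N} :=
  [set i | [exists a, exists b, (a != b) && (enum_val i == beta j a b)]].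

Lemma card_preim_basis (f : 'I_m -> {set E}) :
  (#|[set i : 'I_N | [exists x, enum_val i == f x]]| <= m)%N.
Proof.
rewrite -(card_imset _ enum_val_inj) -[leqRHS]card_ord -cardsT.
apply: leq_trans (leq_imset_card f _); apply: subset_leq_card.
apply/fintype.subsetP => _ /imsetP[i] /[!inE] /existsP[x /eqP ->] ->.
by apply: imset_f; rewrite inE.
Qed.

(** [P] collects the bases among the pairs that [degenerate_basis] supplies, at most [m] for each of
    its two maps. *)
Lemma block_equations_rank j A : A \in equation_classes ->
  exists2 P : {set 'I_N}, (#|P| <= 2 * m)%N &
    forall u : 'cV[R]_N, (forall x, x \in A :&: block_equations j -> equation_form x *m u = 0) ->
      (forall i, i \in P -> u i 0 = 0) -> forall i, i \in block_coords j -> u i 0 = 0.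
Proof.
rewrite inE => /asboolP[nu vnu <-].
have [p1 [p2 Hp]] := degenerate_basis (fin_sym j) (valuation_four_point j vnu).
pose P1 (p : 'I_m -> 'I_m) := [set i : 'I_N | [exists x, enum_val i == beta j x (p x)]].
exists (P1 p1 :|: P1 p2) => [|u u_eq u_P i].
  by rewrite mul2n -addnn; apply: leq_trans (leq_card_setU _ _) (leq_add _ _); apply: card_preim_basis.
rewrite inE => /existsP[a /existsP[b /andP[ab /eqP iE]]].
have zero p x : (forall i, i \in P1 p -> u i 0 = 0) -> at_basis u (beta j x (p x)) = 0.
  move=> up; have [/basis_index[k kE]|] := boolP (beta j x (p x) \in bases M); last exact: at_nonbasis.
  by rewrite -kE at_basisE; apply: up; rewrite inE; apply/existsP; exists x; rewrite kE.
rewrite -at_basisE iE.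
apply: (Hp (fun a b => at_basis u (beta j a b))) => //.
- by move=> a' b'; rewrite (block_sym sysB).
- by move=> a' b' c' d' deg; apply/equation_formE/u_eq; rewrite !inE deg eqxx.
- by move=> x; apply: zero => k kP; apply: u_P; rewrite inE kP.
- by move=> x; apply: zero => k kP; apply: u_P; rewrite inE kP orbT.
- by rewrite /fin -iE enum_valP.
Qed.

Lemma num_cells_bound (L : R) (k D n : nat) : 0 <= L -> (0 < #|J|)%N -> (0 < n)%N ->
  (#|bases M| <= n)%N -> (#|J| * D <= t * n)%N -> (D <= n)%N ->
  finite_set (fan_cells R M) /\
  (num_cells R M)%:R <= ((4 * m) ^ m)%:R ^+ k *
     expR (expR (- L) * (#|J| * m ^ 4)%:R + L * iter k (dim_step (2 * m) D n) n%:R).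
Proof.
move=> L0 J0 n0 Mn JD Dn.
have [fin_cells le_cells] := num_cells_le (fun nu nu' _ _ => @equations_determine nu nu').
split=> //; apply: le_trans (_ : #|equation_classes|%:R <= _); first by rewrite ler_nat.
have cardQ : #|Q| = (#|J| * m ^ 4)%N by rewrite !card_prod !card_ord; congr (_ * _)%N; lia.
rewrite -cardQ.
apply: (@greedy_count _ _ _ _ equation_form valid equation_classes block_equations
  block_coords _ _ t D n _ _ _ _ _ _ _ _ L k finset.set0) => //.
- by move=> A; rewrite inE => /asboolP[nu _ <-]; apply: equations_closed.
- exact: card_block_equations.
- exact: block_equations_rank.
- move=> i; have iM := enum_valP i.
  apply: leq_trans (block_cover sysB (etrans (card_basis iM) rankM)) _.
  by apply/eq_leq/eq_card => j; rewrite !inE.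
- by move=> A _; apply: finset.sub0set.
- by rewrite ler_nat; apply: leq_trans (leq_subr _ _) Mn.
Qed.

End CountingCells.

(** * Contractions and restrictions as blocks *)

Section BlockSystems.
Local Open Scope set_scope.
Variable E : finType.
Implicit Types (S U B W : {set E}).

Definition sets_of_card (k : nat) := {S : {set E} | #|S| == k}.

Lemma card_sets_of_card k : #|{: sets_of_card k}| = 'C(#|E|, k).
Proof. by rewrite card_sig -card_draws; apply: eq_card => S; rewrite !inE. Qed.

Lemma set_enumeration W m : #|W| = m ->
  exists s : 'I_m -> E, injective s /\ forall x, x \in W <-> exists i, s i = x.
Proof.
move=> <-; exists (fun i => enum_val i); split=> [|x]; first exact: enum_val_inj.
split=> [xW|[i <-]]; last exact: enum_valP.
by exists (enum_rank_in xW x); rewrite enum_rankK_in.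
Qed.

(** Stated pointwise, these incompatibilities let the set identities below close by Boolean case
    analysis. *)
Lemma neq_both (x y z : E) : y != z -> ~~ ((x == y) && (x == z)).
Proof. by move=> yz; apply/negP => /andP[/eqP -> ]; apply/negP. Qed.

Lemma notin_both S (x y : E) : y \notin S -> ~~ ((x \in S) && (x == y)).
Proof. by move=> yS; apply/negP => /andP[xS /eqP xy]; rewrite -xy xS in yS. Qed.

Lemma in_imp S (x y : E) : y \in S -> (x == y) ==> (x \in S).
Proof. by move=> yS; apply/implyP => /eqP ->. Qed.

Lemma swap_pair_add S (p q u v : E) : uniq [:: p; q; u; v] ->
    all (fun x => x \notin S) [:: p; q; u; v] ->
  u |: (add_pair S p q :\ p) = add_pair S q u /\
  (p |: add_pair S u v) :\ u = add_pair S p v.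
Proof.
rewrite uniq4 => /and5P[pq pu pv qu /andP[qv uv]] /= /and5P[pS qS uS vS _].
split; apply/setP => x; rewrite !inE;
  move: (neq_both x pq) (neq_both x pu) (neq_both x pv) (neq_both x qu)
    (neq_both x uv) (notin_both x pS) (notin_both x uS);
  by case: (x == p); case: (x == q); case: (x == u); case: (x == v); case: (x \in S).
Qed.

Lemma swap_pair_del U (p q u v : E) : uniq [:: p; q; u; v] ->
    all (mem U) [:: p; q; u; v] ->
  p |: ((U :\: [set p; q]) :\ u) = U :\: [set q; u] /\
  (u |: (U :\: [set u; v])) :\ p = U :\: [set p; v].
Proof.
rewrite uniq4 => /and5P[pq pu pv qu /andP[qv uv]] /= /and5P[pU qU uU vU _].
split; apply/setP => x; rewrite !inE;
  move: (neq_both x pq) (neq_both x pu) (neq_both x pv) (neq_both x qu)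
    (neq_both x uv) (in_imp x pU) (in_imp x uU);
  by case: (x == p); case: (x == q); case: (x == u); case: (x == v); case: (x \in U).
Qed.

Lemma add_pairC S (p q : E) : add_pair S p q = add_pair S q p.
Proof. by rewrite /add_pair finset.setUC finset.setUC [[set p; q]]finset.setUC. Qed.

(** Rank-2 contractions: [sigma j] labels the [m] points outside the s-set [j]. *)
Lemma add_block_system s m : #|E| = (s + m)%N ->
  exists beta : sets_of_card s -> 'I_m -> 'I_m -> {set E},
    block_system s.+2 'C(s.+2, 2) beta.
Proof.
move=> cardE.
have /choice[sigma sigmaP] (j : sets_of_card s) : exists f : 'I_m -> E,
    injective f /\ forall x, x \in ~: val j <-> exists i, f i = x.
  by apply: set_enumeration; rewrite cardsCs finset.setCK (eqP (valP j)) cardE addKn.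
have inj j := (sigmaP j).1; have surj j x := (sigmaP j).2 x.
have out j i : sigma j i \notin val j by rewrite -finset.in_setC surj; exists i.
have uniq_s j a b c d : uniq [:: a; b; c; d] ->
    uniq [:: sigma j a; sigma j b; sigma j c; sigma j d].
  by move=> ?; rewrite -[X in uniq X]/(map (sigma j) [:: a; b; c; d]) map_inj_uniq.
exists (fun j a b => add_pair (val j) (sigma j a) (sigma j b)); split.
- by move=> j a b; apply: add_pairC.
- move=> j a b ab; rewrite /add_pair finset.setUC -finset.setUA !cardsU1 !inE.
  by rewrite !negb_or !out (inj_eq (inj j)) ab (eqP (valP j)).
- move=> j a b c d abcd; have abcd' := uniq_s j _ _ _ _ abcd.
  have outs a' b' c' d' : all (fun x => x \notin val j)
    [:: sigma j a'; sigma j b'; sigma j c'; sigma j d'] by rewrite /= !out.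
  have ne := abcd'; rewrite uniq4 in ne; case/and5P: ne => ab ac ad bc /andP[bd cd].
  exists (sigma j a).
    by rewrite !inE eqxx (negbTE (out j a)) (negbTE ac) (negbTE ad).
  move=> f; rewrite !inE !negb_or => /andP[/andP[fS _]].
  rewrite (negbTE fS) /= => /orP[]/eqP ->.
    by have [-> ->] := swap_pair_add abcd' (outs a b c d); rewrite eqxx !orbT.
  have abdc : uniq [:: sigma j a; sigma j b; sigma j d; sigma j c].
    by rewrite uniq4 ab ac ad bc bd eq_sym cd.
  have [-> E2] := swap_pair_add abdc (outs a b d c).
  by rewrite (add_pairC _ (sigma j c)) E2 eqxx !orbT.
(* Every s-subset of [B] gives a block containing [B]. *)
- move=> B cardB; apply: leq_trans (_ : #|[set S : {set E} | S \subset B & #|S| == s]| <= _)%N.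
    by rewrite cards_draws cardB -(@bin_sub s.+2 2) // subn2.
  rewrite -[leqRHS](card_imset _ val_inj); apply: subset_leq_card.
  apply/fintype.subsetP => S; rewrite inE => /andP[SB cardS].
  pose j : sets_of_card s := Sub S cardS; apply/imsetP; exists j => //; rewrite inE.
  have /cards2P[p [q [pq DE]]] : #|B :\: S| == 2.
    by rewrite cardsDS // cardB (eqP cardS) subSn ?leqnSn // subSnn.
  have pD : p \in B :\: S by rewrite DE !inE eqxx.
  have qD : q \in B :\: S by rewrite DE !inE eqxx orbT.
  have [a ea] : exists i, sigma j i = p by apply/surj; move: pD; rewrite !inE => /andP[].
  have [b eb] : exists i, sigma j i = q by apply/surj; move: qD; rewrite !inE => /andP[].
  apply/existsP; exists a; apply/existsP; exists b.
  rewrite -(inj_eq (inj j)) ea eb pq /add_pair -DE /=; apply/eqP/setP => x; rewrite !inE.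
  by case: (boolP (x \in S)) => // /(fintype.subsetP SB).
- move=> S a b c d [cardS] abcd notS.
  have jP : #|S| == s by apply/eqP.
  pose j : sets_of_card s := Sub S jP.
  have idx x : x \in [:: a; b; c; d] -> exists i, sigma j i = x.
    by move=> xs; rewrite -surj inE; apply: (allP notS).
  have [a' ea] : exists i, sigma j i = a by apply: idx; rewrite !inE eqxx ?orbT.
  have [b' eb] : exists i, sigma j i = b by apply: idx; rewrite !inE eqxx ?orbT.
  have [c' ec] : exists i, sigma j i = c by apply: idx; rewrite !inE eqxx ?orbT.
  have [d' ed] : exists i, sigma j i = d by apply: idx; rewrite !inE eqxx ?orbT.
  exists j, a', b', c', d'; rewrite ea eb ec ed; split=> //.
  by rewrite -(map_inj_uniq (inj j)) /= ea eb ec ed.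
Qed.

(** The dual blocks: a basis in the block of [U] is [U] minus a pair, so [B] is covered once for
    each pair added from its complement. *)
Lemma del_block_system r m : m = r.+2 ->
  exists beta : sets_of_card m -> 'I_m -> 'I_m -> {set E},
    block_system r 'C(#|E| - r, 2) beta.
Proof.
move=> mE.
have /choice[sigma sigmaP] (j : sets_of_card m) : exists f : 'I_m -> E,
    injective f /\ forall x, x \in val j <-> exists i, f i = x.
  by apply: set_enumeration; apply/eqP/(valP j).
have inj j := (sigmaP j).1; have surj j x := (sigmaP j).2 x.
have mem_s j i : sigma j i \in val j by rewrite surj; exists i.
exists (fun j a b => val j :\: [set sigma j a; sigma j b]); split.
- by move=> j a b; rewrite [[set _; _]]finset.setUC.
- move=> j a b ab; rewrite cardsDS ?(eqP (valP j)) ?cards2 ?(inj_eq (inj j)) ?ab ?mE ?subn2 //.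
  by rewrite finset.subUset !finset.sub1set !mem_s.
- move=> j a b c d abcd.
  have uniq_s : uniq [:: sigma j a; sigma j b; sigma j c; sigma j d].
    by rewrite -[X in uniq X]/(map (sigma j) [:: a; b; c; d]) map_inj_uniq.
  have mems a' b' c' d' : all (mem (val j))
    [:: sigma j a'; sigma j b'; sigma j c'; sigma j d'] by rewrite /= !mem_s.
  have ne := uniq_s; rewrite uniq4 in ne; case/and5P: ne => ab ac ad bc /andP[bd cd].
  (* The elements of [U - {a, b}] missing from [U - {c, d}] are [c] and [d]. *)
  exists (sigma j c).
    by rewrite !inE eqxx mem_s (eq_sym _ (sigma j a)) (negbTE ac) (eq_sym _ (sigma j b)) (negbTE bc).
  move=> f; rewrite !inE => /andP[/nandP[|]]; last by move=> fj /andP[_ fj']; rewrite fj' in fj.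
  rewrite negbK => /orP[]/eqP -> _.
    have [-> ->] := swap_pair_del uniq_s (mems a b c d).
    by rewrite eqxx !orbT.
  have bacd : uniq [:: sigma j b; sigma j a; sigma j c; sigma j d].
    by rewrite uniq4 eq_sym ab bc bd ac ad cd.
  have [E1 ->] := swap_pair_del bacd (mems b a c d).
  by rewrite [[set sigma j a; sigma j b]]finset.setUC E1 eqxx.
- move=> B cardB; apply: leq_trans (_ : #|[set D : {set E} | D \subset ~: B & #|D| == 2]| <= _)%N.
    by rewrite cards_draws cardsCs finset.setCK cardB.
  rewrite -[leqRHS](card_imset _ val_inj).
  rewrite -(@card_in_imset _ _ (fun D => B :|: D)); last first.
    move=> D D'; rewrite !inE => /andP[DB _] /andP[D'B _] eD; apply/setP => x.
    have := congr1 (fun A : {set E} => x \in A) eD; rewrite /= !inE.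
    have := fintype.subsetP DB x; have := fintype.subsetP D'B x; rewrite !inE.
    by case: (x \in B) => //= H1 H2 _; apply/idP/idP => [/H2|/H1].
  apply: subset_leq_card; apply/fintype.subsetP => _ /imsetP[D + ->].
  rewrite inE => /andP[DB cardD].
  have BD : B :&: D = finset.set0.
    by apply/eqP; rewrite finset.setI_eq0 disjoint_sym finset.disjoints_subset.
  have cardU : #|B :|: D| == m by rewrite cardsU BD cards0 subn0 cardB (eqP cardD) mE addn2.
  pose j : sets_of_card m := Sub (B :|: D) cardU; apply/imsetP; exists j => //; rewrite inE.
  have /cards2P[p [q [pq DE]]] := cardD.
  have [a ea] : exists i, sigma j i = p by apply/surj; rewrite !inE DE !inE eqxx orbT.
  have [b eb] : exists i, sigma j i = q by apply/surj; rewrite !inE DE !inE eqxx !orbT.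
  apply/existsP; exists a; apply/existsP; exists b.
  rewrite -(inj_eq (inj j)) ea eb pq -DE /=; apply/eqP/setP => x; rewrite !inE.
  have := congr1 (fun A : {set E} => x \in A) BD; rewrite !inE.
  by case: (x \in B); case: (x \in D).
- move=> S a b c d cardS abcd notS.
  have memU x : x \in [:: a; b; c; d] -> x \in S :|: [set x in [:: a; b; c; d]].
    by move=> xs; apply/finset.setUP; right; rewrite finset.in_set.
  have jP : #|S :|: [set x in [:: a; b; c; d]]| == m.
    rewrite cardsU (_ : S :&: _ = finset.set0).
      by rewrite cards0 subn0 cardsE (card_uniqP abcd) /= mE -cardS !addnS addn0.
    apply/setP => x; rewrite finset.in_setI finset.in_set0 [x \in [set _ in _]]finset.in_set.
    by apply/negP => /andP[xS /(allP notS) /negP].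
  pose j : sets_of_card m := Sub (S :|: [set x in [:: a; b; c; d]]) jP.
  have idx x : x \in [:: a; b; c; d] -> exists i, sigma j i = x by move=> xs; apply/surj/memU.
  have [a' ea] : exists i, sigma j i = a by apply: idx; rewrite !inE eqxx ?orbT.
  have [b' eb] : exists i, sigma j i = b by apply: idx; rewrite !inE eqxx ?orbT.
  have [c' ec] : exists i, sigma j i = c by apply: idx; rewrite !inE eqxx ?orbT.
  have [d' ed] : exists i, sigma j i = d by apply: idx; rewrite !inE eqxx ?orbT.
  (* With [U = S + {a, b, c, d}], the set [Sac] is [U - {b, d}], so the labels are those of the
     complementary pairs. *)
  exists j, b', a', d', c'; rewrite ea eb ec ed; split.
    have abcd' : uniq [:: a'; b'; c'; d'] by rewrite -(map_inj_uniq (inj j)) /= ea eb ec ed.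
    move: abcd'; rewrite !uniq4 => /and5P[ab ac ad bc /andP[bd cd]].
    by rewrite eq_sym ab bd bc ad ac eq_sym cd.
  move: (abcd) (notS); rewrite uniq4 => /and5P[ab ac ad bc /andP[bd cd]] /= /and5P[aS bS cS dS _].
  by split; apply/setP => x; rewrite !inE;
    move: (neq_both x ab) (neq_both x ac) (neq_both x ad) (neq_both x bc) (neq_both x bd)
      (neq_both x cd) (notin_both x aS) (notin_both x bS) (notin_both x cS) (notin_both x dS);
    case: (x == a); case: (x == b); case: (x == c); case: (x == d); case: (x \in S).
Qed.

End BlockSystems.

(** * Numerical estimates *)

Section Estimates.
Variable R : realType.

Lemma expR1_le3 : expR 1 <= 3 :> R.
Proof.
have h : (7 / 8 : R) <= expR (- (1 / 8)) by have := expR_ge1Dx (- (1 / 8) : R); lra.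
have : (7 / 8 : R) ^+ 8 <= expR (- (1 / 8)) ^+ 8 by apply: lerXn2r; rewrite ?nnegrE ?expR_ge0 //; lra.
rewrite -expRM_natl (_ : 8%:R * - (1 / 8) = - 1 :> R); last by field.
rewrite expRN => le8; have e0 : 0 < expR 1 :> R := expR_gt0 _.
rewrite -[leLHS]invrK -[leRHS]invrK lef_pV2 ?posrE ?invr_gt0 //.
by apply: le_trans le8; lra.
Qed.

Lemma le4_expR : 4 <= expR (3 / 2) :> R.
Proof.
have h : (9 / 8 : R) <= expR (1 / 8) by have := expR_ge1Dx (1 / 8 : R); lra.
have : (9 / 8 : R) ^+ 12 <= expR (1 / 8) ^+ 12 by apply: lerXn2r; rewrite ?nnegrE ?expR_ge0 //; lra.
rewrite -expRM_natl (_ : 12%:R * (1 / 8) = 3 / 2 :> R); last by field.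
by apply: le_trans; lra.
Qed.

(** The step contracts by [1 - D / N] towards its fixed point [N q / D]. *)
Lemma iter_dim_step (q D N k : nat) : (0 < D)%N -> (D <= N)%N ->
  iter k (@dim_step R q D N) N%:R <= N%:R * (q%:R / D%:R + expR (- (D%:R / N%:R * k%:R))).
Proof.
move=> D0 DN; have N0 : 0 < N%:R :> R by rewrite ltr0n (leq_trans D0).
have {}D0 : 0 < D%:R :> R by rewrite ltr0n.
have iterE : iter k (@dim_step R q D N) N%:R <= N%:R * (q%:R / D%:R + (1 - D%:R / N%:R) ^+ k).
  have d1 : D%:R / N%:R <= 1 :> R by rewrite ler_pdivrMr // mul1r ler_nat.
  elim: k => [|k IHk] /=.
    have q0 : 0 <= q%:R / D%:R :> R by rewrite divr_ge0 // ler0n.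
    by rewrite expr0; nra.
  rewrite /dim_step; set x := iter _ _ _ in IHk *.
  have /ler_wpM2l/(_ _ _ IHk) le_x : 0 <= 1 - D%:R / N%:R :> R by lra.
  apply: (le_trans (lerD le_x (lexx q%:R))); rewrite exprS le_eqVlt; apply/orP; left; apply/eqP.
  by field; rewrite !gt_eqF.
apply: le_trans iterE _; rewrite ler_pM2l // lerD2l.
rewrite -[X in expR X]mulNr expRM_natr.
apply: lerXn2r; rewrite ?nnegrE ?expR_ge0 ?subr_ge0 ?ler_pdivrMr ?mul1r ?ler_nat //.
exact: expR_ge1Dx.
Qed.

Lemma cells_estimate (c j m n N : nat) : (5 <= n)%N -> (n + 4 <= 2 * m)%N -> (m <= n)%N ->
  (j <= N)%N -> ('C(m, 2) <= N)%N ->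
  (forall (L : R) k, 0 <= L -> c%:R <= ((4 * m) ^ m)%:R ^+ k *
     expR (expR (- L) * (j * m ^ 4)%:R + L * iter k (@dim_step R (2 * m) 'C(m, 2) N) N%:R)) ->
  ln (c%:R : R) <= (55 * ln n%:R + 4 * ln n%:R ^+ 2) / n%:R * N%:R.
Proof.
move=> n5 nm mn jN DN bound.
have n0 : 0 < n%:R :> R by rewrite ltr0n; lia.
have n0' := lt0r_neq0 n0.
pose l : R := ln n%:R; rewrite -/l.
have expl : expR l = n%:R by rewrite lnK.
have n5R : 5 <= n%:R :> R by rewrite (ler_nat R 5).
have l1 : 1 <= l.
  rewrite -ler_expR expl; apply: le_trans expR1_le3 _; lra.
have mR : m%:R <= n%:R :> R by rewrite ler_nat.
have nmR : n%:R + 4 <= 2 * m%:R :> R by rewrite -(natrM _ 2) -natrD ler_nat.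
have D2 : 'C(m, 2)%:R * 2 = m%:R * (m%:R - 1) :> R.
  have := congr1 (fun x => x%:R : R) (mul_bin_diag m 1).
  rewrite bin1 !natrM -subn1 natrB; last by lia.
  by move=> ->; rewrite mulrC.
set D := 'C(m, 2) in DN bound D2 *.
have DR : 0 < D%:R :> R by nra.
have D_gt0 : (0 < D)%N by rewrite -(ltr_nat R).
have DNR : D%:R <= N%:R :> R by rewrite ler_nat.
have NR : 0 < N%:R :> R := lt_le_trans DR DNR.
have D0 := lt0r_neq0 DR; have N0 := lt0r_neq0 NR.
pose p : R := N%:R / n%:R.
have p0 : 0 < p by rewrite divr_gt0.
pose x : R := N%:R / D%:R * l.
have x0 : 0 <= x by rewrite mulr_ge0 ?divr_ge0 ?ltW //; lra.
(* [k] is [(N / D) ln n] rounded up, so that the exponential term in [iter_dim_step] is at most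
   [1 / n]. *)
have /andP[xk kx] := truncn_itv x0; pose k := (Num.truncn x).+1.
have kR : k%:R = (Num.truncn x)%:R + 1 :> R by rewrite -natr1.
(* Since [D = m (m - 1) / 2], the left side is [2 N / (m - 1)], and [2 (m - 1)] is at least [n]. *)
have ratio : N%:R / D%:R * m%:R <= 4 * p.
  rewrite /p mulrAC mulrA ler_pdivrMr // mulrAC ler_pdivlMr // -subr_ge0.
  have -> : 4 * N%:R * D%:R - N%:R * m%:R * n%:R
      = N%:R * m%:R * (2 * m%:R - 2 - n%:R) :> R.
    by transitivity (2 * N%:R * ('C(m, 2)%:R * 2) - N%:R * m%:R * n%:R : R); [ring|rewrite D2; ring].
  by rewrite !mulr_ge0 ?ler0n //; lra.
(* This pays for rounding up [k]. *)
have m_le : m%:R <= 4 * p.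
  by apply: le_trans ratio; rewrite ler_peMl // ler_pdivlMr // mul1r.
have km : k%:R * m%:R <= 4 * p * (l + 1).
  have : k%:R * m%:R <= (x + 1) * m%:R by rewrite ler_wpM2r // kR lerD2r.
  by rewrite /x; nra.
have cover_time : l <= D%:R / N%:R * k%:R.
  have -> : l = D%:R / N%:R * x by rewrite /x; field; rewrite D0 N0.
  by rewrite ler_wpM2l ?divr_ge0 ?ltW.
have types : ((4 * m) ^ m)%:R ^+ k <= expR (k%:R * m%:R * (l + 3 / 2)) :> R.
  have le_4m : (4 * m)%:R <= expR (l + 3 / 2) :> R.
    by rewrite expRD expl natrM mulrC ler_pM ?ler0n // le4_expR.
  rewrite -mulrA !expRM_natl natrX; apply: lerXn2r; rewrite ?nnegrE ?exprn_ge0 ?expR_ge0 //.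
  by apply: lerXn2r; rewrite ?nnegrE ?expR_ge0.
(* There are at most [N n ^ 4] equations; [5 l] brings their weighted number down to [p], and the
   [- 1] costs a factor [expR 1], at most 3. *)
pose L : R := 5 * l - 1.
have L0 : 0 <= L by rewrite /L; clear -l1; lra.
have equations_left : expR (- L) * (j * m ^ 4)%:R <= 3 * p.
  have -> : expR (- L) = expR 1 / n%:R ^+ 5.
    by rewrite -expl -(expRM_natl 5) -expRB; congr expR; rewrite /L; ring.
  apply: (@le_trans _ _ (3 / n%:R ^+ 5 * (N%:R * n%:R ^+ 4))); last first.
    by rewrite le_eqVlt; apply/orP; left; apply/eqP; rewrite /p; field.
  rewrite ler_pM ?divr_ge0 ?expR_ge0 ?exprn_ge0 ?ler0n //.
    by rewrite ler_wpM2r ?invr_ge0 ?exprn_ge0 ?ler0n // expR1_le3.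
  by rewrite -natrX -natrM ler_nat leq_mul // leq_exp2r.
(* The fixed point with [q = 2 m] contributes [8 p], and the exponential term contributes
   [N / n = p]. *)
have dims : iter k (@dim_step R (2 * m) D N) N%:R <= 9 * p.
  apply: le_trans (iter_dim_step _ _ D_gt0 DN) _.
  have : expR (- (D%:R / N%:R * k%:R)) <= expR (- l) by rewrite ler_expR lerN2.
  rewrite (expRN l) expl.
  have : N%:R * ((2 * m)%:R / D%:R) <= 8 * p.
    by rewrite natrM mulrA mulrC; move: ratio; rewrite mulrAC => le_p; clear -le_p; lra.
  rewrite mulrDr => le1 /(ler_wpM2l (ltW NR)) le2; apply: (le_trans (lerD le1 le2)).
  by rewrite /p; clear; lra.
have le_c : c%:R <= expR (4 * p * (l + 1) * (l + 3 / 2) + (3 * p + L * (9 * p))) :> R.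
  apply: le_trans (bound L k L0) _; rewrite [leRHS]expRD; apply: ler_pM;
    rewrite ?exprn_ge0 ?expR_ge0 ?ler0n //.
    apply: le_trans types _; rewrite ler_expR ler_wpM2r //; clear -l1; lra.
  by rewrite ler_expR lerD // ler_wpM2l.
(* The constant terms [6 + 3 - 9] cancel, and the linear terms [10 l + 45 l] give [55 l]. *)
have eq_total : 4 * p * (l + 1) * (l + 3 / 2) + (3 * p + L * (9 * p)) =
    (55 * l + 4 * l ^+ 2) / n%:R * N%:R.
  by rewrite /L /p; field.
rewrite -eq_total; case: (posnP c) => [->|c0].
  rewrite ln0 // eq_total mulr_ge0 ?divr_ge0 ?ltW //.
  by clear -l1; nra.
by rewrite -ler_expR lnK ?posrE ?ltr0n.
Qed.

End Estimates.

(** * The bound *)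

(** Both sides count pairs of disjoint sets of sizes [k] and [j]; this yields the incidence count
    between blocks and r-sets. *)
Lemma bin_mul_bin n k j : (k + j <= n)%N ->
  ('C(n, k) * 'C(n - k, j) = 'C(n, k + j) * 'C(k + j, j))%N.
Proof.
move=> kjn; have kn : (k <= n)%N by lia.
have jnk : (j <= n - k)%N by lia.
apply/eqP; rewrite -(@eqn_pmul2r (k`! * (j`! * (n - k - j)`!))) ?muln_gt0 ?fact_gt0 //.
apply/eqP; transitivity n`!.
  by rewrite mulnACA bin_fact // -(bin_fact kn) mulnA.
have := bin_fact kjn; have := bin_fact (leq_addl k j).
rewrite addnK subnDA => <- <-; lia.
Qed.

Lemma leq_bin_diag n k s : ('C(n, k) <= 'C(n + s, k + s))%N.
Proof.
elim: s => [|s IHs]; first by rewrite !addn0.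
by apply: leq_trans IHs _; rewrite !addnS binS leq_addl.
Qed.

Theorem theorem6 (R : realType) (E : finType) (M : matroid E) (r n : nat)
    (hr : mrank M = r) (hn : #|E| = n) (hr3 : (3 <= r)%N) :
  finite_set (fan_cells R M) /\
  ln ((num_cells R M)%:R : R)
    <= (55 * ln n%:R + 4 * (ln n%:R) ^+ 2) / n%:R * 'C(n, r)%:R.
Proof.
have [B0 B0M] := set0Pn _ (bases_neq0 M).
have rn : (r <= n)%N by rewrite -hr -(card_basis B0M) -hn; apply: max_card.
(* A triple needs [r + 2] elements. With fewer, all valuations are equivalent and there is at most
   one cell, whose logarithm is 0. *)
have [small|large] := ltnP n (r + 2).
  have no_triples (nu : basis_space R M) : degenerate_triples nu = classical_sets.set0.
    apply/seteqP; split=> // x0 [S [a [b [c [d [cardS abcd notS _ _]]]]]].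
    have : uniq ([:: a; b; c; d] ++ enum (mem S)).
      rewrite cat_uniq abcd enum_uniq andbT; apply/hasPn => x; rewrite mem_enum => xS.
      by apply/negP => /(allP notS); rewrite xS.
    have sizeS : size (enum (mem S)) = #|S| by rewrite cardE.
    move/card_uniqP; rewrite size_cat sizeS /= => card4.
    by have := max_card (mem ([:: a; b; c; d] ++ enum (mem S))); rewrite card4 hn; lia.
  have [fin_cells le1] := @num_cells_le R E M unit (fun _ => tt) 
    (fun nu nu' _ _ _ => etrans (no_triples nu) (esym (no_triples nu'))).
  split=> //; apply: (@le_trans _ _ 0).
    apply: ln_le0; rewrite (ler_nat R _ 1); apply: leq_trans le1 _.
    by apply: leq_trans (max_card _) _; rewrite card_unit.
  have n0 : 1 <= n%:R :> R by rewrite (ler_nat R 1); lia.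
  have l0 := ln_ge0 n0.
  by rewrite mulr_ge0 ?divr_ge0 ?addr_ge0 ?mulr_ge0 ?exprn_ge0.
have bases_le : (#|bases M| <= 'C(n, r))%N.
  rewrite -hn -card_draws; apply: subset_leq_card; apply/fintype.subsetP => B BM.
  by rewrite inE (card_basis BM) hr.
have N0 : (0 < 'C(n, r))%N by rewrite bin_gt0.
(* Applied to the kind of block whose size [m] is at least [n / 2 + 2]. *)
have conclude m s t (beta : sets_of_card E s -> 'I_m -> 'I_m -> {set E}) :
    block_system r t beta -> (n + 4 <= 2 * m)%N -> (m <= n)%N -> (s <= n)%N ->
    ('C(n, s) * 'C(m, 2) = t * 'C(n, r))%N -> (t <= 'C(m, 2))%N -> ('C(m, 2) <= 'C(n, r))%N ->
    finite_set (fan_cells R M) /\ ln ((num_cells R M)%:R : R)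
      <= (55 * ln n%:R + 4 * (ln n%:R) ^+ 2) / n%:R * 'C(n, r)%:R.
  move=> sys nm mn sn JD tD DN.
  have cardJ : #|{: sets_of_card E s}| = 'C(n, s) by rewrite card_sets_of_card hn.
  have J0 : (0 < #|{: sets_of_card E s}|)%N by rewrite cardJ bin_gt0.
  have bound (L : R) k (L0 : 0 <= L) := @num_cells_bound R E M _ m r t beta hr sys L k
    'C(m, 2) 'C(n, r) L0 J0 N0 bases_le (eq_leq (etrans (congr1 (fun x => x * _)%N cardJ) JD)) DN.
  split; first by have [] := bound 0 0%N (lexx _).
  apply: (@cells_estimate R _ #|{: sets_of_card E s}| m) => //; first by lia.
    (* The number of blocks times [D] is [t N], with [t] at most [D], so the blocks number at most
       [N]. *)
    rewrite cardJ -(@leq_pmul2r 'C(m, 2)); last by rewrite bin_gt0; lia.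
    by rewrite JD mulnC leq_mul2l tD orbT.
  by move=> L k L0; have [] := bound L k L0.
(* Contractions have [m = n - r + 2] and the dual blocks [m = r + 2]; [n + 4 <= 2 * m] holds for the
   former when [2 * r <= n] and for the latter otherwise. *)
have [half|half] := leqP (2 * r) n.
  have [s rE] : exists s, r = s.+2 by exists r.-2; lia.
  have sn : (s <= n)%N by lia.
  have [beta sys] := add_block_system (etrans hn (esym (subnKC sn))).
  rewrite -rE in sys; apply: (conclude _ _ _ _ sys); try lia.
  - by rewrite bin_mul_bin ?addn2 -?rE 1?mulnC //; lia.
  - by apply: leq_bin2l; lia.
  - by have := leq_bin_diag (n - s) 2 s; rewrite subnK // add2n -rE.
have [beta sys] := @del_block_system E r r.+2 erefl.
rewrite hn in sys; apply: (conclude _ _ _ _ sys); try lia.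
- have := @bin_mul_bin n r 2; rewrite addn2 => <-; last by lia.
  by rewrite mulnC.
- by apply: leq_bin2l; lia.
- by rewrite -(@bin_sub r.+2 2) // subn2; apply: leq_bin2l; lia.
Qed.
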